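(* In scheme (H) of the context choose $\bar\lambda_{k+1}=\lambda_k+\frac{\alpha_k}{\theta_k}(Av_k+Bw_k-b)$. Then (H) becomes the following algorithm, started with $(x_0,v_0)\in\mathcal X\times\mathcal X$: $$\begin{cases}u_k=(x_k+\alpha_kv_k)/(1+\alpha_k),\\ \bar\lambda_{k+1}=\lambda_k+\frac{\alpha_k}{\theta_k}(Av_k+Bw_k-b),\\ v_{k+1}=\operatorname{prox}^{\mathcal X}_{s_kf_2}\left[\widetilde v_k-s_k(\nabla f_1(u_k)+A^\top\bar\lambda_{k+1})\right],\quad s_k=\alpha_k/\widetilde\eta_{f,k},\\ x_{k+1}=(x_k+\alpha_kv_{k+1})/(1+\alpha_k),\\ y_{k+1}=\operatorname{prox}^{\mathcal Y}_{\tau_kg}(\widetilde y_k-\tau_kB^\top\bar\lambda_{k+1}),\quad\tau_k=\alpha_k^2/\eta_{g,k},\\ w_{k+1}=y_{k+1}+(y_{k+1}-y_k)/\alpha_k,\\ \lambda_{k+1}=\lambda_k+\frac{\alpha_k}{\theta_k}(Av_{k+1}+Bw_{k+1}-b).\end{cases}$$ Assume $g\in\mathcal S^0_{\mu_g}(\mathcal Y)$ with $\mu_g\ge0$; $f=f_1+f_2$ with $f_2\in\mathcal S^0_0(\mathcal X)$ and $f_1\in\mathcal S^{1,1}_{\mu_f,L_f}(\mathcal X)$, $0\le\mu_f\le L_f<\infty$; $\gamma_0=\mu_f$ if $\mu_f>0$ and $\beta_0=\mu_g$ if $\mu_g>0$; and that the step sizes satisfy, for all $k$, $$\left(L_f\beta_k\theta_k+2\beta_k\|A\|^2+2\gamma_k\|B\|^2\right)\alpha_k^2=\gamma_k\beta_k\theta_k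 .$$ Then $\{(x_k,y_k)\}_{k\ge1}\subset\mathcal X\times\mathcal Y$ and $\mathcal E_k\le\theta_k\mathcal E_0$ for all $k$. If moreover $\gamma_0\beta_0\le L_f\beta_0+2\beta_0\|A\|^2+2\gamma_0\|B\|^2$, then $$\|Ax_k+By_k-b\|\le\theta_k\mathcal R_0,\qquad|F(x_k,y_k)-F^*|\le\theta_k(\mathcal E_0+\|\lambda^*\|\mathcal R_0),$$ where $\mathcal R_0=\sqrt{2\mathcal E_0}+\|\lambda_0-\lambda^*\|+\|Ax_0+By_0-b\|$, and, for all $k\ge1$, $$\theta_k\le C\left(\min\left\{\frac{\|B\|}{\sqrt{\beta_0}\,k},\ \frac{\|B\|^2}{\mu_gk^2}\right\}+\min\left\{\frac{\|A\|}{\sqrt{\gamma_0}\,k}+\frac{L_f}{\gamma_0k^2},\ \frac{\|A\|^2}{\mu_fk^2}+\exp\left(-\frac k4\sqrt{\frac{\mu_f}{L_f}}\right)\right\}\right)$$ with a constant $C>0$ independent of $k$, $A$, $B$, $\mu_f$, $\mu_g$, $\gamma_0$ and $\beta_0$.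
   Context: Setting. $\mathcal X\subset\mathbb R^m$, $\mathcal Y\subset\mathbb R^n$ are closed convex sets, $A\in\mathbb R^{r\times m}$, $B\in\mathbb R^{r\times n}$, $b\in\mathbb R^r$, and $f:\mathbb R^m\to\mathbb R\cup\{+\infty\}$, $g:\mathbb R^n\to\mathbb R\cup\{+\infty\}$ are proper closed convex. The problem is to minimize $F(x,y)=f(x)+g(y)$ over $x\in\mathcal X,y\in\mathcal Y$ subject to $Ax+By=b$. $\mathcal L(x,y,\lambda)=F(x,y)+\delta_{\mathcal X\times\mathcal Y}(x,y)+\langle\lambda,Ax+By-b\rangle$ ($\delta$: indicator function). $(x^*,y^*,\lambda^* )\in\mathcal X\times\mathcal Y\times\mathbb R^r$ is a saddle point of $\mathcal L$ (assumed to exist): $\mathcal L(x^*,y^*,\lambda)\le\mathcal L(x^*,y^*,\lambda^* )\le\mathcal L(x,y,\lambda^* )$ for all $(x,y,\lambda)$; $F^*=F(x^*,y^* )$. Norms are Euclidean, and $\|A\|,\|B\|$ are the induced operator norms. $h\in\mathcal S^0_\mu(\mathcal X)$ means $h$ is proper closed convex and $h(x_1)-h(x_2)-\langle p,x_1-x_2\rangle\ge\frac\mu2\|x_1-x_2\|^2$ for all $x_1,x_2\in\mathcal X$, $p\in\partial h(x_2)$. $h\in\mathcal S^{1,1}_{\mu,L}(\mathcal X)$ means $h\in\mathcal S^0_\mu(\mathcal X)$ and $h$ has $L$-Lipschitz gradient in the sense $h(x_1)-h(x_2)-\langle\nabla h(x_2),x_1-x_2\rangle\le\frac L2\|x_1-x_2\|^2$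 for all $x_1,x_2\in\mathcal X$. The classes over $\mathcal Y$ are analogous. $\operatorname{prox}^{\mathcal X}_{sh}(z)=\operatorname{argmin}_{x\in\mathcal X}\{h(x)+\frac1{2s}\|x-z\|^2\}$, and similarly $\operatorname{prox}^{\mathcal Y}_{\tau g}$. Parameters. $\theta_0=1$, $\gamma_0>0$, $\beta_0>0$, step sizes $\alpha_k>0$, and $$\frac{\theta_{k+1}-\theta_k}{\alpha_k}=-\theta_{k+1},\quad\frac{\gamma_{k+1}-\gamma_k}{\alpha_k}=\mu_f-\gamma_{k+1},\quad\frac{\beta_{k+1}-\beta_k}{\alpha_k}=\mu_g-\beta_{k+1}.$$ $\widetilde\eta_{f,k}=\gamma_k+\mu_f\alpha_k$, $\widetilde v_k=\frac1{\widetilde\eta_{f,k}}(\gamma_kv_k+\mu_f\alpha_ku_k)$, $\eta_{g,k}=(\alpha_k+1)\beta_k+\mu_g\alpha_k$, $\widetilde y_k=y_k+\frac{\alpha_k\beta_k}{\eta_{g,k}}(w_k-y_k)$. Scheme (H), from an initial guess $(x_0,v_0,y_0,w_0,\lambda_0)$ with $(x_0,v_0)\in\mathcal X\times\mathcal X$; it is implicit, with the value $\bar\lambda_{k+1}$ (to be chosen) treated as a fixed vector inside the argmins: $$\begin{cases}u_k=(x_k+\alpha_kv_k)/(1+\alpha_k),\\ v_{k+1}=\operatorname{argmin}_{v\in\mathcal X}\{f_2(v)+\langle\nabla f_1(u_k)+A^\top\bar\lambda_{k+1},v\rangle+\frac{\widetilde\eta_{f,k}}{2\alpha_k}\|v-\widetilde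 v_k\|^2\},\\ x_{k+1}=(x_k+\alpha_kv_{k+1})/(1+\alpha_k),\\ y_{k+1}=\operatorname{argmin}_{y\in\mathcal Y}\{g(y)+\langle By,\bar\lambda_{k+1}\rangle+\frac{\eta_{g,k}}{2\alpha_k^2}\|y-\widetilde y_k\|^2\},\\ w_{k+1}=y_{k+1}+(y_{k+1}-y_k)/\alpha_k,\\ \lambda_{k+1}=\lambda_k+\frac{\alpha_k}{\theta_k}(Av_{k+1}+Bw_{k+1}-b).\end{cases}$$ Discrete Lyapunov function: $\mathcal E_k=\mathcal L(x_k,y_k,\lambda^* )-\mathcal L(x^*,y^*,\lambda_k)+\frac{\gamma_k}2\|v_k-x^*\|^2+\frac{\beta_k}2\|w_k-y^*\|^2+\frac{\theta_k}2\|\lambda_k-\lambda^*\|^2$. Convention: a term with $\mu_f$ (resp. $\mu_g$) in the denominator is $+\infty$ when $\mu_f=0$ (resp. $\mu_g=0$); the exponential is $1$ when $\mu_f=0$.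
   Formalization: In the strong-convexity inequality defining S^0_mu(D), p ranges over subgradients of h plus the indicator of D, not of h on the whole space; literally read, a g with no subgradients on Y (e.g. -sqrt(y_1) on Y={0}xR) belongs to S^0_1(Y) vacuously and the claim fails. *)

(* Defs.v *)
From mathcomp Require Export all_boot all_order all_algebra.
From mathcomp Require Export all_classical all_reals all_analysis.

Set Implicit Arguments.
Unset Strict Implicit.
Unset Printing Implicit Defensive.

Export Order.TTheory GRing.Theory Num.Theory.
Export numFieldNormedType.Exports.

Global Open Scope classical_set_scope.
Global Open Scope ring_scope.

Section Euclidean.
Context {R : realType}.

Definition dot {n : nat} (x y : 'cV[R]_n) : R := \sum_(i < n) x i 0 * y i 0.

(* The library's norm `|x| on matrices is the max norm, not this one; both
   give the same topology. *)
Definition enorm {n : nat} (x : 'cV[R]_n) : R := Num.sqrt (dot x x).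

Definition opnorm {p q : nat} (M : 'M[R]_(p, q)) : R :=
  sup [set enorm (M *m x) | x in [set x : 'cV[R]_q | enorm x <= 1]].

End Euclidean.

Section ConvexAnalysis.
Context {R : realType} {n : nat}.
Implicit Types (D : set 'cV[R]_n) (h : 'cV[R]_n -> \bar R) (x p : 'cV[R]_n).

Local Open Scope ereal_scope.

Definition indicator {T : Type} (D : set T) (x : T) : \bar R :=
  if x \in D then 0 else +oo.

Definition proper_fun h :=
  (forall x, h x != -oo) /\ (exists x, h x < +oo).

Definition convex_efun h :=
  forall x z (t : R), (0 < t < 1)%R ->
    h (t *: x + (1 - t) *: z)%R <= t%:E * h x + (1 - t)%:E * h z.

(* "Closed" means closed epigraph, i.e. lower semicontinuity. *)
Definition proper_closed_convex h :=
  [/\ proper_fun h, lower_semicontinuous h & convex_efun h].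

Definition subdiff h x : set 'cV[R]_n :=
  [set p | h x \is a fin_num /\ forall z, h x + (dot p (z - x))%:E <= h z].

(* The values are meaningful at points where [differentiable_at] holds. *)
Definition grad h x : 'cV[R]_n :=
  (\col_i 'D_(delta_mx i 0) (fun z => fine (h z)) x)%R.

Definition differentiable_at h x :=
  (\forall z \near x, h z \is a fin_num) /\
  differentiable (fun z => fine (h z)) x.

(* As a function on D, h is identified with h + indicator D, and its
   subgradients at a point of D are those of that sum.  They are the subgradients
   of h itself when D is the whole space, and in general the sums of one of them
   and a normal vector of D as soon as the subdifferential sum rule holds (a
   normal vector does not affect the inequality below).  With the subgradients
   of h on the whole space the inequality would say nothing at points of D where
   h has no such subgradient. *)
Definition class_S0 (mu : R) D h :=
  proper_closed_convex h /\
  forall x1 x2 p, D x1 -> D x2 ->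
    subdiff (fun z => h z + indicator D z) x2 p ->
    (mu / 2 * enorm (x1 - x2) ^+ 2)%:E <= h x1 - h x2 - (dot p (x1 - x2))%:E.

Definition class_S11 (mu L : R) D h :=
  [/\ class_S0 mu D h,
      forall x, D x -> differentiable_at h x
    & forall x1 x2, D x1 -> D x2 ->
        h x1 - h x2 - (dot (grad h x2) (x1 - x2))%:E
          <= (L / 2 * enorm (x1 - x2) ^+ 2)%:E].

(* As usual, a function identically +oo on D has no minimizer on D. *)
Definition argmin D h : set 'cV[R]_n :=
  [set x | [/\ D x, h x < +oo & forall z, D z -> h x <= h z]].

Definition prox D (s : R) h (z : 'cV[R]_n) : set 'cV[R]_n :=
  argmin D (fun x => h x + (1 / (2 * s) * enorm (x - z) ^+ 2)%:E).

End ConvexAnalysis.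

Section Problem.
Context {R : realType} {m n r : nat}.
Variables (X : set 'cV[R]_m) (Y : set 'cV[R]_n).
Variables (A : 'M[R]_(r, m)) (B : 'M[R]_(r, n)) (b : 'cV[R]_r).
Variables (f : 'cV[R]_m -> \bar R) (g : 'cV[R]_n -> \bar R).

Definition objective (x : 'cV[R]_m) (y : 'cV[R]_n) : \bar R := (f x + g y)%E.

Definition lagrangian (x : 'cV[R]_m) (y : 'cV[R]_n) (l : 'cV[R]_r) : \bar R :=
  (objective x y + indicator (X `*` Y) (x, y)
   + (dot l (A *m x + B *m y - b))%:E)%E.

Definition saddle_point (xs : 'cV[R]_m) (ys : 'cV[R]_n) (ls : 'cV[R]_r) :=
  [/\ X xs, Y ys &
      forall x y l,
        (lagrangian xs ys l <= lagrangian xs ys ls)%E /\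
        (lagrangian xs ys ls <= lagrangian x y ls)%E].

End Problem.

Definition parameters {R : realType} (mu_f mu_g : R)
    (alpha theta gamma beta : nat -> R) :=
  [/\ theta 0%N = 1, 0 < gamma 0%N, 0 < beta 0%N, forall k, 0 < alpha k
    & forall k,
      [/\ (theta k.+1 - theta k) / alpha k = - theta k.+1,
          (gamma k.+1 - gamma k) / alpha k = mu_f - gamma k.+1
        & (beta k.+1 - beta k) / alpha k = mu_g - beta k.+1]].

Section Schemes.
Context {R : realType} {m n r : nat}.
Variables (X : set 'cV[R]_m) (Y : set 'cV[R]_n).
Variables (A : 'M[R]_(r, m)) (B : 'M[R]_(r, n)) (b : 'cV[R]_r).
Variables (f1 f2 : 'cV[R]_m -> \bar R) (g : 'cV[R]_n -> \bar R).
Variables (mu_f mu_g : R) (alpha theta gamma beta : nat -> R).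
Variables (u v x : nat -> 'cV[R]_m) (y w : nat -> 'cV[R]_n).
Variables (lam lbar : nat -> 'cV[R]_r).

Definition eta_f (k : nat) : R := gamma k + mu_f * alpha k.

Definition v_tilde (k : nat) : 'cV[R]_m :=
  (eta_f k)^-1 *: (gamma k *: v k + (mu_f * alpha k) *: u k).

Definition eta_g (k : nat) : R := (alpha k + 1) * beta k + mu_g * alpha k.

Definition y_tilde (k : nat) : 'cV[R]_n :=
  y k + (alpha k * beta k / eta_g k) *: (w k - y k).

(* Only the values of lbar at positive indices are relevant. *)
Definition lbar_choice :=
  forall k, lbar k.+1 = lam k + (alpha k / theta k) *: (A *m v k + B *m w k - b).

Definition scheme_H :=
  [/\ X (x 0%N), X (v 0%N) & forall k,
    [/\ [/\ u k = (1 + alpha k)^-1 *: (x k + alpha k *: v k),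
            argmin X
              (fun z => f2 z
                 + (dot (grad f1 (u k) + A^T *m lbar k.+1) z)%:E
                 + (eta_f k / (2 * alpha k) * enorm (z - v_tilde k) ^+ 2)%:E)%E
              (v k.+1)
          & x k.+1 = (1 + alpha k)^-1 *: (x k + alpha k *: v k.+1)],
        argmin Y
          (fun z => g z
             + (dot (B *m z) (lbar k.+1))%:E
             + (eta_g k / (2 * alpha k ^+ 2) * enorm (z - y_tilde k) ^+ 2)%:E)%E
          (y k.+1),
        w k.+1 = y k.+1 + (alpha k)^-1 *: (y k.+1 - y k)
      & lam k.+1
          = lam k + (alpha k / theta k) *: (A *m v k.+1 + B *m w k.+1 - b)]].

Definition algorithm :=
  [/\ X (x 0%N), X (v 0%N), lbar_choice & forall k,
    let s := alpha k / eta_f k in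
    let tau := alpha k ^+ 2 / eta_g k in
    [/\ [/\ u k = (1 + alpha k)^-1 *: (x k + alpha k *: v k),
            prox X s f2
              (v_tilde k - s *: (grad f1 (u k) + A^T *m lbar k.+1))
              (v k.+1)
          & x k.+1 = (1 + alpha k)^-1 *: (x k + alpha k *: v k.+1)],
        prox Y tau g (y_tilde k - tau *: (B^T *m lbar k.+1)) (y k.+1),
        w k.+1 = y k.+1 + (alpha k)^-1 *: (y k.+1 - y k)
      & lam k.+1
          = lam k + (alpha k / theta k) *: (A *m v k.+1 + B *m w k.+1 - b)]].

Definition lyapunov (f : 'cV[R]_m -> \bar R)
    (xs : 'cV[R]_m) (ys : 'cV[R]_n) (ls : 'cV[R]_r) (k : nat) : \bar R :=
  (lagrangian X Y A B b f g (x k) (y k) ls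
   - lagrangian X Y A B b f g xs ys (lam k)
   + (gamma k / 2 * enorm (v k - xs) ^+ 2)%:E
   + (beta k / 2 * enorm (w k - ys) ^+ 2)%:E
   + (theta k / 2 * enorm (lam k - ls) ^+ 2)%:E)%E.

End Schemes.

Section Rate.
Context {R : realType}.

Definition div_oo (a c : R) : \bar R := if c == 0 then +oo%E else (a / c)%:E.

(* nA, nB stand for the operator norms of A, B; g0, b0 for gamma_0, beta_0.
   For mu_f = 0 the exponential is expR 0 = 1, whatever the value of Lf. *)
Definition rate (nA nB Lf mu_f mu_g g0 b0 : R) (k : nat) : \bar R :=
  (Order.min (nB / (Num.sqrt b0 * k%:R))%:E
             (div_oo (nB ^+ 2) (mu_g * k%:R ^+ 2))
   + Order.min (nA / (Num.sqrt g0 * k%:R) + Lf / (g0 * k%:R ^+ 2))%:E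
               (div_oo (nA ^+ 2) (mu_f * k%:R ^+ 2)
                + (expR (- (k%:R / 4 * Num.sqrt (mu_f / Lf))))%:E))%E.

End Rate.

(* Main.v *)
Require Import Defs.
From mathcomp Require Import ring lra.

(** For [f] and [g] separately, the optimality conditions of the two argmins,
    strong convexity and the descent inequality for [f1] bound the change of
    the corresponding part of the Lyapunov function.  Adding the multiplier
    part, all that is left is
      [theta/2 |lam' - lbar'|^2 - (gamma - L alpha^2)/2 |v' - v|^2
         - beta/2 |w' - w|^2],
    which the step-size rule makes nonpositive; hence [(1 + alpha) E' <= E].
    The residual is controlled because [lam_k - (A x_k + B y_k - b)/theta_k]
    is constant.

    For the decay of [theta], the step-size rule says that the squares of
    [alpha sqrt (L/gamma)], [alpha sqrt 2 |A| / sqrt (gamma theta)] and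
    [alpha sqrt 2 |B| / sqrt (beta theta)] add up to 1, so the sum of these
    numbers is at least 1.  As [alpha <= 1], each of them is at most the
    increment of a function of [theta_k] of the form [- c ln theta],
    [c / sqrt theta] or [c / theta].  Summing, [k] is at most the sum of the
    three functions at [theta_k], and one of them takes a fixed share of [k]. *)

Set Implicit Arguments.
Unset Strict Implicit.
Unset Printing Implicit Defensive.

(** * Euclidean norm and convex analysis *)

Section Dot.
Context {R : realType} {n : nat}.
Implicit Types (x y z : 'cV[R]_n) (a : R).

Lemma dotC x y : dot x y = dot y x.
Proof. by apply: eq_bigr => i _; rewrite mulrC. Qed.

Lemma dotDl x y z : dot (x + y) z = dot x z + dot y z.
Proof. by rewrite -big_split; apply: eq_bigr => i _; rewrite mxE mulrDl. Qed.

Lemma dotZl a x y : dot (a *: x) y = a * dot x y.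
Proof. by rewrite mulr_sumr; apply: eq_bigr => i _; rewrite mxE mulrA. Qed.

Lemma dotDr x y z : dot x (y + z) = dot x y + dot x z.
Proof. by rewrite dotC dotDl !(dotC x). Qed.

Lemma dotZr a x y : dot x (a *: y) = a * dot x y.
Proof. by rewrite dotC dotZl dotC. Qed.

Lemma dotNl x y : dot (- x) y = - dot x y.
Proof. by rewrite -scaleN1r dotZl mulN1r. Qed.

Lemma dotNr x y : dot x (- y) = - dot x y.
Proof. by rewrite dotC dotNl dotC. Qed.

Lemma dot0l x : dot 0 x = 0.
Proof. by rewrite -(scale0r 0) dotZl mul0r. Qed.

Definition dotE := (dotDl, dotDr, dotZl, dotZr, dotNl, dotNr).

Lemma dot_ge0 x : 0 <= dot x x.
Proof. by apply: sumr_ge0 => i _; rewrite -expr2 sqr_ge0. Qed.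

Lemma dot_eq0 x : (dot x x == 0) = (x == 0).
Proof.
apply/eqP/eqP => [x0|->]; last exact: dot0l.
apply/matrixP => i j; rewrite ord1 mxE; apply/eqP.
rewrite -sqrf_eq0 expr2 eq_le -{1}x0 /dot (bigD1 i)//= lerDl -expr2 sqr_ge0 andbT.
by apply: sumr_ge0 => k _; rewrite -expr2 sqr_ge0.
Qed.

Lemma enorm_ge0 x : 0 <= enorm x.
Proof. exact: sqrtr_ge0. Qed.

Lemma enorm_sqr x : enorm x ^+ 2 = dot x x.
Proof. by rewrite sqr_sqrtr// dot_ge0. Qed.

Lemma enorm_eq0 x : (enorm x == 0) = (x == 0).
Proof. by rewrite -sqrf_eq0 enorm_sqr dot_eq0. Qed.

Lemma enormZ a x : enorm (a *: x) = `|a| * enorm x.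
Proof.
by rewrite /enorm dotZl dotZr mulrA -expr2 sqrtrM ?sqr_ge0// sqrtr_sqr.
Qed.

Lemma enorm0 : enorm (0 : 'cV[R]_n) = 0.
Proof. by rewrite /enorm dot0l sqrtr0. Qed.

Lemma enormN x : enorm (- x) = enorm x.
Proof. by rewrite -scaleN1r enormZ normrN1 mul1r. Qed.

(** Cauchy-Schwarz: expand the square of [enorm y *: x - enorm x *: y] and divide by the product of
    the norms, zero vectors being set aside. *)
Lemma dot_le_enorm x y : dot x y <= enorm x * enorm y.
Proof.
have [/eqP|x0] := eqVneq (enorm x) 0.
  by rewrite enorm_eq0 => /eqP->; rewrite dot0l mulr_ge0 ?enorm_ge0.
have [/eqP|y0] := eqVneq (enorm y) 0.
  by rewrite enorm_eq0 => /eqP->; rewrite dotC dot0l mulr_ge0 ?enorm_ge0.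
have px : 0 < enorm x by rewrite lt_def x0 enorm_ge0.
have py : 0 < enorm y by rewrite lt_def y0 enorm_ge0.
have := dot_ge0 (enorm y *: x - enorm x *: y).
rewrite !dotE (dotC y x) -!enorm_sqr => h.
rewrite -(ler_pM2l (mulr_gt0 px py)) -subr_ge0; nra.
Qed.

Lemma ler_enormD x y : enorm (x + y) <= enorm x + enorm y.
Proof.
rewrite -(ler_pXn2r (n := 2)) ?nnegrE ?addr_ge0 ?enorm_ge0//.
rewrite sqrrD !enorm_sqr !dotE (dotC y x).
have := dot_le_enorm x y; lra.
Qed.

Lemma normr_dot_le x y : `|dot x y| <= enorm x * enorm y.
Proof.
rewrite ler_norml dot_le_enorm andbT lerNl -dotNl -(enormN x).
exact: dot_le_enorm.
Qed.

End Dot.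

(** * Operator norm *)

Section OperatorNorm.
Context {R : realType} {p q : nat}.
Implicit Types (M : 'M[R]_(p, q)).

Lemma dot_mulmxl M x y : dot (M *m x) y = dot x (M^T *m y).
Proof.
have -> : dot (M *m x) y = \sum_i \sum_j M i j * x j 0 * y i 0.
  by apply: eq_bigr => i _; rewrite mxE mulr_suml.
rewrite exchange_big/=; apply: eq_bigr => i _; rewrite mxE mulr_sumr.
by apply: eq_bigr => j _; rewrite mxE mulrCA mulrA.
Qed.

(** Cauchy-Schwarz on each row, with the Frobenius norm as bound. It makes the set in [opnorm]
    bounded, without which its [sup] would carry no information. *)
Lemma enorm_mulmx_bounded M : exists2 K : R, 0 <= K &
  forall x, enorm (M *m x) <= K * enorm x.
Proof.
pose K := \sum_i enorm (row i M)^T ^+ 2.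
exists (Num.sqrt K); first exact: sqrtr_ge0.
move=> x; rewrite -(ler_pXn2r (n := 2)) ?nnegrE ?mulr_ge0 ?enorm_ge0 ?sqrtr_ge0//.
rewrite exprMn [X in _ <= X * _]sqr_sqrtr; last first.
  by apply: sumr_ge0 => i _; rewrite sqr_ge0.
rewrite enorm_sqr mulr_suml; apply: ler_sum => i _.
rewrite -expr2 -exprMn -real_normK ?num_real// -[leRHS]real_normK ?num_real//.
rewrite ler_pXn2r ?nnegrE// (ger0_norm (mulr_ge0 _ _)) ?enorm_ge0//.
apply: le_trans (normr_dot_le _ _).
by rewrite mxE /dot; under [in leRHS]eq_bigr do rewrite !mxE.
Qed.

Lemma enorm_mulmx M x : enorm (M *m x) <= opnorm M * enorm x.
Proof.
have [/eqP|x0] := eqVneq (enorm x) 0.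
  by rewrite enorm_eq0 => /eqP->; rewrite mulmx0 !enorm0 mulr0.
have px : 0 < enorm x by rewrite lt_def x0 enorm_ge0.
rewrite -ler_pdivrMr//; apply: ub_le_sup.
  have [K K0 MK] := enorm_mulmx_bounded M.
  exists K => _ [z/= z1 <-]; apply: le_trans (MK z) _.
  by rewrite ler_piMr.
exists ((enorm x)^-1 *: x) => /=.
  by rewrite enormZ ger0_norm ?invr_ge0 ?enorm_ge0// mulVf.
by rewrite -scalemxAr enormZ ger0_norm ?invr_ge0 ?enorm_ge0// mulrC.
Qed.

Lemma opnorm_ge0 M : 0 <= opnorm M.
Proof.
have [K K0 MK] := enorm_mulmx_bounded M.
apply: ub_le_sup; last first.
  by exists 0; rewrite /= ?mulmx0 enorm0.
exists K => _ [z/= z1 <-]; apply: le_trans (MK z) _.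
by rewrite ler_piMr.
Qed.

End OperatorNorm.

(** * Convex sets and functions, and the optimality condition of an argmin *)

Section Convexity.
Context {R : realType} {n : nat}.
Implicit Types (D : set 'cV[R]_n) (h : 'cV[R]_n -> \bar R) (x z : 'cV[R]_n).

Lemma comb_line x z (t : R) : t *: z + (1 - t) *: x = x + t *: (z - x).
Proof. by rewrite scalerBl scalerBr scale1r addrCA. Qed.

Lemma convex_set_comb D x z (t : R) : convex_set D -> 0 <= t -> t <= 1 ->
  D x -> D z -> D (t *: x + (1 - t) *: z).
Proof.
move=> cD t0 t1 Dx Dz; apply/set_mem.
exact: (cD x z (Itv01 t0 t1) (mem_set Dx) (mem_set Dz)).
Qed.

Lemma convex_set_avg D x z (a : R) : convex_set D -> 0 <= a ->
  D x -> D z -> D ((1 + a)^-1 *: (x + a *: z)).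
Proof.
move=> cD a0 Dx Dz.
have -> : (1 + a)^-1 *: (x + a *: z)
    = (1 + a)^-1 *: x + (1 - (1 + a)^-1) *: z.
  by rewrite scalerDr scalerA; congr (_ + _ *: _); field; lra.
apply: convex_set_comb => //; first by rewrite invr_ge0; lra.
by rewrite invf_le1; lra.
Qed.

Lemma ge0_affine_at0 (K S : R) :
  (forall t, 0 < t < 1 -> 0 <= K + t * S) -> 0 <= K.
Proof.
move=> KS; rewrite leNgt; apply/negP => K0.
have d0 : 0 < 2 * (`|S| - K) by have := normr_ge0 S; lra.
(* For [K < 0] this [t] makes [t * |S|] at most [- K / 2], hence [K + t * S < 0]. *)
pose t := - K / (2 * (`|S| - K)).
have t01 : 0 < t < 1.
  rewrite divr_gt0 ?oppr_gt0//= ltr_pdivrMr//.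
  by have := normr_ge0 S; lra.
have tE : t * (2 * (`|S| - K)) = - K by rewrite /t divfK// gt_eqF.
have := KS t t01; have := ler_norm S; have := normr_ge0 S.
by move: tE t01 => + /andP[]; nra.
Qed.

Lemma convex_efun_line h x z (a b t : R) : convex_efun h ->
  h x = a%:E -> h z = b%:E -> 0 < t < 1 ->
  (h (x + t *: (z - x))%R <= (a + t * (b - a))%:E)%E.
Proof.
move=> ch hx hz t01; have := ch z x t t01.
rewrite hx hz -!EFinM -EFinD => /le_trans-/(_ _ (lexx _)).
rewrite comb_line.
by congr (_ <= _%:E)%E; ring.
Qed.

Lemma argmin_fin D h (e : 'cV[R]_n -> R) x : (forall z, h z != -oo%E) ->
  argmin D (fun z => h z + (e z)%:E)%E x -> h x \is a fin_num.
Proof.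
move=> hNy [_ + _]; rewrite fin_numE hNy/=.
by case: (h x).
Qed.

(** Compare [x] with [x + t (z - x)]: convexity bounds the change of [h] by [t (h z - h x)], and the
    quadratic term contributes its derivative and a remainder of order [t^2]. Divide by [t] and let
    it tend to 0. The linear term is a function [l] because one of the argmins writes it as
    [dot (B *m z) lbar]. *)
Lemma argmin_subgradient D h (l : 'cV[R]_n -> R) c z0 (q : R) x :
  convex_set D -> (forall z, h z != -oo%E) -> convex_efun h ->
  (forall z, l z = dot c z) ->
  argmin D (fun z => h z + (l z)%:E + (q * enorm (z - z0) ^+ 2)%:E)%E x ->
  forall z, D z -> (h x + (dot (- c - (2 * q) *: (x - z0))%R (z - x)%R)%:E <= h z)%E.
Proof.
move=> cD hNy ch lE xmin z Dz.
have /fineK : h x \is a fin_num.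
  apply: (@argmin_fin D _ (fun z => l z + q * enorm (z - z0) ^+ 2)) => //.
  by under eq_fun do rewrite EFinD addeA.
case: xmin => Dx _ xmin; set a := fine _ => hx.
move: (hNy z); case hz: (h z) => [b | |]// _; last by rewrite leey.
rewrite -hx -EFinD lee_fin -subr_ge0.
apply: (@ge0_affine_at0 _ (q * dot (z - x) (z - x))) => t t01.
have Dp : D (x + t *: (z - x)).
  rewrite -comb_line.
  by case/andP: t01 => /ltW ? /ltW ?; exact: convex_set_comb.
have := @convex_efun_line h x z a b t ch (esym hx) hz t01.
have := xmin _ Dp; have := hNy (x + t *: (z - x)).
case: (h (x + _)) => [p | |]// _; rewrite -hx -!EFinD !lee_fin !lE.
have -> : x + t *: (z - x) - z0 = (x - z0) + t *: (z - x) by rewrite addrAC.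
move: (z - x) (x - z0) t01 => d w /andP[t0 t1]; rewrite !enorm_sqr !dotE.
rewrite (dotC d w) => lo up.
rewrite -(pmulr_rge0 _ t0); lra.
Qed.

End Convexity.

(** * Gradients and subgradients *)

Section Gradient.
Context {R : realType} {n : nat}.
Implicit Types (h : 'cV[R]_n -> \bar R) (x z d : 'cV[R]_n).

(** The differential is linear, hence determined by its values on the canonical basis, which are the
    entries of [grad]. *)
Lemma dot_grad h x d : differentiable_at h x ->
  dot (grad h x) d = 'D_d (fun z => fine (h z)) x.
Proof.
move=> [_ dh]; rewrite deriveE//.
rewrite [in RHS](matrix_sum_delta d) linear_sum/=; apply: eq_bigr => i _.
by rewrite big_ord_recl big_ord0 addr0 linearZ/= mxE deriveE// mulrC.
Qed.

(** By convexity the difference quotient from [x] towards [z] is at most [h z - h x] for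
    [0 < t < 1]; its limit at [0+] is the directional derivative. *)
Lemma gradient_inequality h x z : convex_efun h -> h z != -oo%E ->
  differentiable_at h x -> (h x + (dot (grad h x) (z - x)%R)%:E <= h z)%E.
Proof.
move=> ch hNy dhx; have [nfin dh] := dhx; rewrite dot_grad//.
have /fineK := nbhs_singleton nfin; set a := fine _ => hx.
move: hNy; case hz: (h z) => [b | |]// _; last by rewrite leey.
rewrite -hx -EFinD lee_fin -lerBrDl leNgt; apply/negP => lt_ba.
have cvD : t^-1 *: (fine (h (t *: (z - x) + x)) - a) @[t --> 0^'+]
    --> 'D_(z - x) (fun z => fine (h z)) x.
  by apply: cvg_dnbhs_at_right; exact: diff_derivable.
(* [fine] erases infinities, so the quotient speaks of [h] only where [h] is finite, which holds
   near [x]. *)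
have fin_near : \forall t \near (0 : R)^'+, h (t *: (z - x) + x) \is a fin_num.
  apply: cvg_within.
  have cvx : (t *: (z - x) + x) @[t --> (0 : R)] --> x.
    rewrite -[X in _ --> X]add0r -(scale0r (z - x)).
    by apply: cvgD; [apply: cvgZr_tmp; exact: cvg_id|exact: cvg_cst].
  exact: (cvx _ nfin).
have [t [t01 ft lt_t]] : exists t, [/\ 0 < t < 1,
    h (t *: (z - x) + x) \is a fin_num
    & b - a < t^-1 *: (fine (h (t *: (z - x) + x)) - a)].
  apply: (@filter_ex _ (0 : R)^'+); near=> t; split.
  - by apply/andP; split; near: t; [exact: nbhs_right_gt|exact: nbhs_right_lt].
  - by near: t.
  - by near: t; exact: (cvgr_gt _ cvD).
have := @convex_efun_line _ _ h x z a b t ch (esym hx) hz t01.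
move: ft lt_t; rewrite addrC => /fineK <-; rewrite lee_fin /= => lt_t.
case/andP: t01 => t0 t1; rewrite -lerBlDl leNgt => /negP; apply.
by move: lt_t; rewrite [_ *: _]mulrC ltr_pdivlMr// mulrC.
Unshelve. all: by end_near. Qed.

(** Outside [D] the sum is [+oo], so an inequality known on [D] alone yields a subgradient of the
    kind that [class_S0] asks for. *)
Lemma subdiff_indicator (D : set 'cV[R]_n) h x p : D x -> h x \is a fin_num ->
  (forall z, h z != -oo%E) ->
  (forall z, D z -> (h x + (dot p (z - x)%R)%:E <= h z)%E) ->
  subdiff (fun z => h z + indicator D z)%E x p.
Proof.
move=> Dx hx hNy hp; rewrite /subdiff/= /indicator mem_set// adde0.
split=> // z; case: ifPn => [/set_mem Dz|_]; first by rewrite adde0; exact: hp.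
by rewrite addey ?leey.
Qed.

End Gradient.

(** * Proximal points as argmins with a linear term *)

Section Prox.
Context {R : realType} {n : nat}.
Implicit Types (D : set 'cV[R]_n) (h : 'cV[R]_n -> \bar R).

Lemma argmin_addr D h1 h2 (c : R) : (forall z, h1 z = h2 z + c%:E)%E ->
  argmin D h1 `<=>` argmin D h2.
Proof.
move=> h12; split=> x [Dx xoo xmin]; split => //.
- by move: xoo; rewrite h12 !ltey; case: (h2 x).
- by move=> z Dz; have := xmin z Dz; rewrite !h12 leeD2rE.
- by rewrite h12 ltey; move: xoo; rewrite ltey; case: (h2 x).
- by move=> z Dz; rewrite !h12 leeD2rE//; exact: xmin.
Qed.

(** Completing the square moves the centre from [z0] to [z0 - s *: c] and leaves a constant. *)
Lemma argmin_prox D h (l : 'cV[R]_n -> R) c z0 (q s : R) x : 0 < s ->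
  q = 1 / (2 * s) -> (forall z, l z = dot c z) ->
  argmin D (fun z => h z + (l z)%:E + (q * enorm (z - z0) ^+ 2)%:E)%E x
  <-> prox D s h (z0 - s *: c) x.
Proof.
move=> s0 -> lE; set h1 := (X in argmin _ X _).
suff [le_ ge_] : argmin D h1 `<=>` prox D s h (z0 - s *: c) by split; auto.
apply: (@argmin_addr _ _ _ (dot c z0 - s / 2 * dot c c)) => z.
rewrite /h1 -!addeA -!EFinD; congr (_ + _%:E)%E; rewrite lE !enorm_sqr.
have -> : z - (z0 - s *: c) = (z - z0) + s *: c by rewrite opprB addrA addrAC.
have -> : dot c z = dot c (z - z0) + dot c z0 by rewrite -dotDr subrK.
move: (z - z0) => d; rewrite !dotE (dotC d c); field.
by rewrite gt_eqF.
Qed.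

End Prox.

(** * One iteration *)

Section Step.
Context {R : realType}.

(** Here [c] is the gradient of [f1] at [u] and [l] is [A^T *m lbar]. The descent inequality from
    [u] to [x'], weighted by [1 + al], meets the gradient inequality at [x] (weight 1) and strong
    convexity at [xs] (weight [al]). Since [x - u = al (u - v)] and [x' - u] is a multiple of
    [v' - v], the gradient terms combine into one along [v' - xs], which the optimality of [v']
    absorbs. *)
Lemma primal_x_step m (x x' u v v' xs c l : 'cV[R]_m)
    (al ga mu L f1x f1x' f1u f1s f2x f2x' f2v' f2s : R) :
  0 < al -> 0 < ga -> 0 <= mu -> 0 <= L ->
  u = (1 + al)^-1 *: (x + al *: v) ->
  x' = (1 + al)^-1 *: (x + al *: v') ->
  f1x' - f1u - dot c (x' - u) <= L / 2 * dot (x' - u) (x' - u) ->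
  f1u + dot c (x - u) <= f1x ->
  mu / 2 * dot (xs - u) (xs - u) <= f1s - f1u - dot c (xs - u) ->
  (1 + al) * f2x' <= f2x + al * f2v' ->
  f2v' + dot (- (c + l) - ((ga + mu * al) / al) *:
      (v' - (ga + mu * al)^-1 *: (ga *: v + (mu * al) *: u))) (xs - v') <= f2s ->
  (1 + al) * (f1x' + f2x') + (ga + mu * al) / 2 * dot (v' - xs) (v' - xs)
  <= f1x + f2x + al * (f1s + f2s) + ga / 2 * dot (v - xs) (v - xs)
     - al * dot l (v' - xs)
     - (ga - L * al ^+ 2) / 2 * dot (v' - v) (v' - v).
Proof.
move=> al0 ga0 mu0 L0 uE x'E h1 h2 h3 h4 h5.
have al1 : 1 + al != 0 by rewrite gt_eqF// addr_gt0.
have eta0 : ga + mu * al != 0 by rewrite gt_eqF// ltr_wpDr// mulr_ge0// ltW.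
(* Everything is written through [v' - xs], [v - xs] and [u - xs]; the rest is algebra of inner
   products. *)
have e1 : x' - u = (al / (1 + al)) *: ((v' - xs) - (v - xs)).
  by rewrite uE x'E; apply/matrixP => i j; rewrite !mxE; field.
have e2 : x - u = al *: ((u - xs) - (v - xs)).
  rewrite [in RHS]uE {1}uE; apply/matrixP => i j; rewrite !mxE; field.
  exact: al1.
have e3 : (- (c + l) - ((ga + mu * al) / al) *:
      (v' - (ga + mu * al)^-1 *: (ga *: v + (mu * al) *: u)))
    = - (c + l) - al^-1 *: (ga *: ((v' - xs) - (v - xs))
                            + (mu * al) *: ((v' - xs) - (u - xs))).
  apply/matrixP => i j; rewrite !mxE; field.
  by rewrite eta0 gt_eqF.
move: h1 h2 h3 h5; rewrite {}e1 {}e2 {}e3 -(opprB u xs) -(opprB v' xs).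
have -> : v' - v = (v' - xs) - (v - xs) by rewrite opprB addrA subrK.
move: (v' - xs) (v - xs) (u - xs) => a b d h1 h2 h3 h5.
have {}h1 : (1 + al) * f1x' <= (1 + al) * f1u + al * dot c (a - b)
              + L * al ^+ 2 / 2 * dot (a - b) (a - b).
  move: h1; rewrite !dotZr !dotZl => h1.
  have N0 := dot_ge0 (a - b).
  have : (1 + al) * f1x' <= (1 + al) * (f1u + al / (1 + al) * dot c (a - b)
     + L / 2 * (al / (1 + al) * (al / (1 + al) * dot (a - b) (a - b)))).
    by rewrite ler_pM2l ?addr_gt0//; lra.
  move=> /le_trans; apply.
  (* The weight cancels one of the two factors [1 / (1 + al)]; the other is bounded by 1. *)
  rewrite [leLHS](_ : _ = (1 + al) * f1u + al * dot c (a - b)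
    + L * al ^+ 2 / 2 * dot (a - b) (a - b) * (1 + al)^-1); last by field.
  rewrite lerD2l ler_piMr//; first by rewrite !mulr_ge0 ?(ltW al0).
  by rewrite invf_le1 ?addr_gt0//; lra.
have {}h3 := ler_wpM2l (ltW al0) h3.
have {}h5 := ler_wpM2l (ltW al0) h5.
have alV : al * al^-1 = 1 by rewrite mulfV// gt_eqF.
have e : al * dot (- (c + l) - al^-1 *: (ga *: (a - b) + (mu * al) *: (a - d))) (- a)
  = al * dot (c + l) a + (ga * dot (a - b) a + mu * al * dot (a - d) a).
  by rewrite !dotE; field; rewrite gt_eqF.
move: h5; rewrite mulrDr e; move: h1 h2 h3.
rewrite !dotE (dotC b a) (dotC d a) => h1 h2 h3 h5.
(* This is [mu * al * |v' - u|^2], left over from polarization. *)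
have := mulr_ge0 (mulr_ge0 mu0 (ltW al0)) (dot_ge0 (a - d)).
rewrite !dotE (dotC d a); lra.
Qed.

(** [q] is a subgradient of [g] at [y']. As [y - y' + al (ys - y') = - al (w' - ys)], the plain
    inequality at [y] plus [al] times the strong one at [ys] involves [q] only along [w' - ys].
    Since [g] is treated implicitly, all of [be / 2 |w' - w|^2] remains. *)
Lemma primal_y_step n (y y' w w' ys l : 'cV[R]_n) (al be mu gy gy' gs : R) :
  0 < al -> 0 < be -> 0 <= mu ->
  w' = y' + al^-1 *: (y' - y) ->
  let eta := (al + 1) * be + mu * al in
  let q := - l - (eta / al ^+ 2) *: (y' - (y + (al * be / eta) *: (w - y))) in
  gy' + dot q (y - y') <= gy ->
  mu / 2 * dot (ys - y') (ys - y') <= gs - gy' - dot q (ys - y') ->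
  (1 + al) * gy' + (be + mu * al) / 2 * dot (w' - ys) (w' - ys)
  <= gy + al * gs + be / 2 * dot (w - ys) (w - ys) - al * dot l (w' - ys)
     - be / 2 * dot (w' - w) (w' - w).
Proof.
move=> al0 be0 mu0 w'E eta q h1 h2.
have eta0 : eta != 0.
  by rewrite gt_eqF// ltr_wpDr ?mulr_gt0 ?addr_gt0// mulr_ge0// ltW.
have al0' : al != 0 by rewrite gt_eqF.
(* The choice of [y_tilde] and [eta_g] makes [al *: q] a combination of [l], [w' - w] and
   [w' - y']. *)
have qE : al *: q = - (al *: l) - (be *: ((w' - ys) - (w - ys))
                                   + (mu * al) *: ((w' - ys) - (y' - ys))).
  rewrite /q w'E /eta; apply/matrixP => i j; rewrite !mxE; field.
  by rewrite al0' eta0.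
have yE : y - y' = - al *: ((w' - ys) - (y' - ys)).
  by rewrite w'E; apply/matrixP => i j; rewrite !mxE; field.
have {}h2 := ler_wpM2l (ltW al0) h2.
have e : dot q (y - y') + al * dot q (ys - y') = - dot (al *: q) (w' - ys).
  by rewrite yE -(opprB y' ys) !dotE; ring.
move: e; rewrite qE => e.
have -> : w' - w = (w' - ys) - (w - ys) by rewrite opprB addrA subrK.
move: h1 h2 e; rewrite -(opprB y' ys).
move: (w' - ys) (w - ys) (y' - ys) => a b d.
rewrite !dotE (dotC b a) (dotC d a) => h1 h2 e.
have := mulr_ge0 (mulr_ge0 mu0 (ltW al0)) (dot_ge0 (a - d)).
rewrite !dotE (dotC d a); lra.
Qed.

(** The terms in [lbar] add up to [al * dot lbar rho], which cancels against the multiplier part. As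
    [lbar] differs from [lam'] only by using the old [v] and [w], the excess [|lam' - lbar|^2] is
    controlled by [|v' - v|^2] and [|w' - w|^2]. By the parameter recursions the left-hand side is
    [1 + al] times the next Lyapunov value, up to terms in [fs + gs]. *)
Lemma primal_dual_step m n r (A : 'M[R]_(r, m)) (B : 'M[R]_(r, n))
    (b lam lam' lbar ls : 'cV[R]_r) (x x' v v' xs : 'cV[R]_m)
    (y y' w w' ys : 'cV[R]_n) (al th ga be muf mug L fx fx' fs gy gy' gs : R) :
  0 < al -> 0 < th ->
  A *m xs + B *m ys = b ->
  x' = (1 + al)^-1 *: (x + al *: v') ->
  w' = y' + al^-1 *: (y' - y) ->
  lbar = lam + (al / th) *: (A *m v + B *m w - b) ->
  lam' = lam + (al / th) *: (A *m v' + B *m w' - b) ->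
  2 * opnorm A ^+ 2 * al ^+ 2 <= th * (ga - L * al ^+ 2) ->
  2 * opnorm B ^+ 2 * al ^+ 2 <= th * be ->
  (1 + al) * fx' + (ga + muf * al) / 2 * dot (v' - xs) (v' - xs)
  <= fx + al * fs + ga / 2 * dot (v - xs) (v - xs)
     - al * dot (A^T *m lbar) (v' - xs)
     - (ga - L * al ^+ 2) / 2 * dot (v' - v) (v' - v) ->
  (1 + al) * gy' + (be + mug * al) / 2 * dot (w' - ys) (w' - ys)
  <= gy + al * gs + be / 2 * dot (w - ys) (w - ys)
     - al * dot (B^T *m lbar) (w' - ys)
     - be / 2 * dot (w' - w) (w' - w) ->
  (1 + al) * (fx' + gy' + dot ls (A *m x' + B *m y' - b))
    + (ga + muf * al) / 2 * dot (v' - xs) (v' - xs)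
    + (be + mug * al) / 2 * dot (w' - ys) (w' - ys)
    + th / 2 * dot (lam' - ls) (lam' - ls)
  <= fx + gy + dot ls (A *m x + B *m y - b) + al * (fs + gs)
    + ga / 2 * dot (v - xs) (v - xs) + be / 2 * dot (w - ys) (w - ys)
    + th / 2 * dot (lam - ls) (lam - ls).
Proof.
move=> al0 th0 feas x'E w'E lbarE lam'E stA stB hx hy.
have al0' : al != 0 by rewrite gt_eqF.
have al1 : 1 + al != 0 by rewrite gt_eqF// addr_gt0.
have th0' : th != 0 by rewrite gt_eqF.
pose rho := A *m v' + B *m w' - b.
have xE : x = (1 + al) *: x' - al *: v' by rewrite x'E scalerA mulfV// scale1r addrK.
have yE : y = (1 + al) *: y' - al *: w'.
  by rewrite w'E; apply/matrixP => i j; rewrite !mxE; field.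
have resE : (1 + al) * dot ls (A *m x' + B *m y' - b)
    = dot ls (A *m x + B *m y - b) + al * dot ls rho.
  rewrite xE yE !mulmxBr -!scalemxAr -dotZr -dotZr -dotDr; congr dot.
  by apply/matrixP => i j; rewrite !mxE; ring.
have rhoE : rho = A *m (v' - xs) + B *m (w' - ys).
  by rewrite /rho -feas !mulmxBr opprD addrACA.
have lbar_rho : dot (A^T *m lbar) (v' - xs) + dot (B^T *m lbar) (w' - ys)
    = dot lbar rho.
  rewrite rhoE [dot lbar _]dotDr ![dot (_^T *m _) _]dotC.
  by rewrite -!dot_mulmxl ![dot _ lbar]dotC.
have dlam : al *: rho = th *: (lam' - lam).
  by rewrite lam'E addrAC subrr add0r scalerA mulrCA mulfV ?mulr1.
(* [2 * |p| |q| <= |p|^2 + |q|^2] gives the factor 2 of the step-size rule. *)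
have gap : th * dot (lam' - lbar) (lam' - lbar)
    <= 2 * opnorm A ^+ 2 * al ^+ 2 / th * dot (v' - v) (v' - v)
       + 2 * opnorm B ^+ 2 * al ^+ 2 / th * dot (w' - w) (w' - w).
  have -> : lam' - lbar = (al / th) *: (A *m (v' - v) + B *m (w' - w)).
    rewrite lam'E lbarE !mulmxBr; apply/matrixP => i j; rewrite !mxE; ring.
  set p := A *m _; set q := B *m _.
  have pA : dot p p <= opnorm A ^+ 2 * dot (v' - v) (v' - v).
    rewrite -!enorm_sqr -exprMn ler_pXn2r ?nnegrE ?enorm_mulmx//.
      exact: enorm_ge0.
    by rewrite mulr_ge0 ?opnorm_ge0 ?enorm_ge0.
  have qB : dot q q <= opnorm B ^+ 2 * dot (w' - w) (w' - w).
    rewrite -!enorm_sqr -exprMn ler_pXn2r ?nnegrE ?enorm_mulmx//.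
      exact: enorm_ge0.
    by rewrite mulr_ge0 ?opnorm_ge0 ?enorm_ge0.
  rewrite dotZl dotZr.
  have -> : th * (al / th * (al / th * dot (p + q) (p + q)))
      = al ^+ 2 / th * dot (p + q) (p + q) by field.
  have -> : 2 * opnorm A ^+ 2 * al ^+ 2 / th * dot (v' - v) (v' - v)
       + 2 * opnorm B ^+ 2 * al ^+ 2 / th * dot (w' - w) (w' - w)
     = al ^+ 2 / th * (2 * (opnorm A ^+ 2 * dot (v' - v) (v' - v))
                       + 2 * (opnorm B ^+ 2 * dot (w' - w) (w' - w))) by ring.
  apply: ler_wpM2l; first by rewrite mulr_ge0 ?invr_ge0 ?sqr_ge0 ?ltW.
  move: (_ * dot (v' - v) _) pA (_ * dot (w' - w) _) qB => P pP Q qQ.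
  have := dot_ge0 (p - q); rewrite !dotE (dotC q p); lra.
have stA' : 2 * opnorm A ^+ 2 * al ^+ 2 / th * dot (v' - v) (v' - v)
    <= (ga - L * al ^+ 2) * dot (v' - v) (v' - v).
  by apply: ler_wpM2r; rewrite ?dot_ge0// ler_pdivrMr// [leRHS]mulrC.
have stB' : 2 * opnorm B ^+ 2 * al ^+ 2 / th * dot (w' - w) (w' - w)
    <= be * dot (w' - w) (w' - w).
  by apply: ler_wpM2r; rewrite ?dot_ge0// ler_pdivrMr// [leRHS]mulrC.
(* Three-point identity for the step [lam' - lam], which equals [(al / th) rho]. *)
have dualE : al * dot ls rho + th / 2 * dot (lam' - ls) (lam' - ls)
    = th / 2 * dot (lam - ls) (lam - ls) + al * dot lbar rho
      + th / 2 * dot (lam' - lbar) (lam' - lbar)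
      - th / 2 * dot (lbar - lam) (lbar - lam).
  rewrite -!dotZr dlam !dotE (dotC lam' ls) (dotC lam ls) (dotC lam' lbar).
  by rewrite (dotC lam lbar); field.
have := dot_ge0 (lbar - lam); rewrite -(pmulr_rge0 _ th0).
rewrite mulrDr resE; move: dualE (congr1 ( *%R al) lbar_rho).
lra.
Qed.

End Step.

(** * Elementary inequalities behind the decay rate *)

Section Decay.
Context {R : realType}.
Implicit Types (a t c : R).

(** [ln (1 + a) >= a / (1 + a) >= a / 2]. Here and in the next two increment lemmas, [t] is
    [theta k] and [t / (1 + a)] is [theta k.+1]. *)
Lemma ln_increment a t : 0 < a -> a <= 1 -> 0 < t ->
  a <= 2 * (ln t - ln (t / (1 + a))).
Proof.
move=> a0 a1 t0.
rewrite ln_div ?posrE ?addr_gt0// subKr.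
have a1' : 0 < 1 + a by rewrite addr_gt0.
have := @le_ln1Dx R (- (a / (1 + a))).
have -> : 1 + - (a / (1 + a)) = (1 + a)^-1 by field; rewrite gt_eqF.
rewrite lnV ?posrE// => /(_ _)h.
have {}h : - ln (1 + a) <= - (a / (1 + a)).
  by apply: h; rewrite ltrN2 ltr_pdivrMr//; lra.
have : a / 2 <= a / (1 + a) by rewrite ler_pM2l// lef_pV2 ?posrE//; lra.
lra.
Qed.

(** From [1 + a / 3 <= sqrt (1 + a)]. *)
Lemma invr_sqrt_increment a t : 0 < a -> a <= 1 -> 0 < t ->
  a / Num.sqrt t <= 3 * ((Num.sqrt (t / (1 + a)))^-1 - (Num.sqrt t)^-1).
Proof.
move=> a0 a1 t0; have a1' : 0 < 1 + a by rewrite addr_gt0.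
rewrite sqrtrM ?(ltW t0)// invfM sqrtrV ?(ltW a1')// invrK.
have st0 : 0 < (Num.sqrt t)^-1 by rewrite invr_gt0 sqrtr_gt0.
have : 1 + a / 3 <= Num.sqrt (1 + a).
  rewrite -(ler_pXn2r (n := 2)) ?nnegrE ?sqrtr_ge0 ?sqr_sqrtr ?(ltW a1')//; nra.
rewrite -subr_ge0 => /(mulr_ge0 (ltW st0)).
move: (Num.sqrt t)^-1 (Num.sqrt (1 + a)) => s r; nra.
Qed.

Lemma invr_increment a t : 0 < a -> 0 < t -> a / t = (t / (1 + a))^-1 - t^-1.
Proof. by move=> a0 t0; field; rewrite !gt_eqF// addr_gt0. Qed.

Lemma sqrt_mulrr c t : 0 <= c -> 0 <= t -> Num.sqrt (c * t * t) = Num.sqrt c * t.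
Proof. by move=> c0 t0; rewrite -mulrA -expr2 sqrtrM// sqrtr_sqr ger0_norm. Qed.

Lemma le_of_invr_sqrt c t (k : R) : 0 < t -> 0 < k -> k / 4 <= c / Num.sqrt t ->
  t <= 16 * (c ^+ 2 / k ^+ 2).
Proof.
move=> t0 k0; have st0 : 0 < Num.sqrt t by rewrite sqrtr_gt0.
rewrite ler_pdivlMr// => h.
rewrite mulrA ler_pdivlMr ?exprn_gt0//.
rewrite -(sqr_sqrtr (ltW t0)) -exprMn [16](_ : _ = 4 ^+ 2); last by ring.
rewrite -exprMn ler_pXn2r ?nnegrE//; [lra | by rewrite mulr_ge0// ltW |].
have := mulr_gt0 st0 k0; lra.
Qed.

Lemma le_of_invr c t (k : R) : 0 < t -> 0 < k -> k / 4 <= c / t -> t <= 4 * (c / k).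
Proof.
by move=> t0 k0; rewrite ler_pdivlMr// mulrA ler_pdivlMr// => h; lra.
Qed.

(** Half of [k] against the coefficient [2 p] gives the exponent [k / (4 p)]; the two bounds above
    take only a quarter. *)
Lemma le_expR_of_ln (p t k : R) : 0 < p -> 0 < t -> k / 2 <= 2 * p * - ln t ->
  t <= expR (- (k / 4 / p)).
Proof.
move=> p0 t0 h; rewrite -(lnK (x := t)) ?posrE// ler_expR lerNr.
rewrite ler_pdivrMr//; lra.
Qed.

(** From [1 + x^2 / 2 <= exp x]; it compares the exponential rate with [L / (mu k^2)]. *)
Lemma expRN_le (x : R) : 0 < x -> expR (- x) <= 2 / x ^+ 2.
Proof.
move=> x0; rewrite expRN -[2 / _]invf_div lef_pV2 ?posrE ?expR_gt0//; last first.
  by rewrite divr_gt0// exprn_gt0.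
by have := expR_ge1Dxn 1 (ltW x0); rewrite !factS fact0 !muln1; lra.
Qed.

Lemma sum3_ge1 (x y z : R) : 0 <= x -> 0 <= y -> 0 <= z ->
  x ^+ 2 + y ^+ 2 + z ^+ 2 = 1 -> 1 <= x + y + z.
Proof.
move=> x0 y0 z0 h; rewrite -(ler_pXn2r (n := 2)) ?nnegrE ?addr_ge0//.
rewrite expr1n -h; nra.
Qed.


Lemma sqrt2_le : Num.sqrt 2 <= 3 / 2 :> R.
Proof.
rewrite -(ler_pXn2r (n := 2)) ?nnegrE ?sqrtr_ge0 ?sqr_sqrtr//; lra.
Qed.

(* The factor 288 is [16 * (3 * sqrt 2) ^ 2]. *)
Lemma decay_sqrt (c m t : R) (k : nat) : 0 <= c -> 0 < m -> 0 < t -> (0 < k)%N ->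
  k%:R / 4 <= 3 * (Num.sqrt 2 * c) / Num.sqrt m / Num.sqrt t ->
  t <= 288 * (c ^+ 2 / (m * k%:R ^+ 2)).
Proof.
move=> c0 m0 t0 k0; have kr : 0 < k%:R :> R by rewrite ltr0n.
move=> /(le_of_invr_sqrt t0 kr)/le_trans; apply.
rewrite !exprMn exprVn !sqr_sqrtr ?(ltW m0)//.
rewrite le_eqVlt; apply/orP; left; apply/eqP; field.
by rewrite !gt_eqF.
Qed.

(** The constant [4 * sqrt 2] is relaxed to the 288 of [decay_sqrt], so that one constant serves all
    cases. *)
Lemma decay_inv (c m t : R) (k : nat) : 0 <= c -> 0 < m -> 0 < t -> (0 < k)%N ->
  k%:R / 4 <= Num.sqrt 2 * c / Num.sqrt m / t ->
  t <= 288 * (c / (Num.sqrt m * k%:R)).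
Proof.
move=> c0 m0 t0 k0; have kr : 0 < k%:R :> R by rewrite ltr0n.
have sm0 : 0 < Num.sqrt m by rewrite sqrtr_gt0.
move=> /(le_of_invr t0 kr)/le_trans; apply.
have -> : 4 * (Num.sqrt 2 * c / Num.sqrt m / k%:R)
    = 4 * Num.sqrt 2 * (c / (Num.sqrt m * k%:R)).
  by field; rewrite !gt_eqF.
apply: ler_wpM2r; first by rewrite divr_ge0// mulr_ge0// ltW.
by have := sqrt2_le; lra.
Qed.

Lemma natr_le_of_increments (T : nat -> R) : 0 <= T 0%N ->
  (forall k, 1 <= T k.+1 - T k) -> forall k, k%:R <= T k.
Proof.
move=> T0 T1; elim=> [//|k IH].
by rewrite -natr1; have := T1 k; lra.
Qed.

End Decay.

(** * Decay of theta *)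

Section Rate.
Context {R : realType}.
Variables (al th ga be : nat -> R) (muf mug a b L : R).
Hypotheses (al0 : forall k, 0 < al k) (al1 : forall k, al k <= 1).
Hypotheses (th0 : th 0%N = 1) (th_gt0 : forall k, 0 < th k).
Hypothesis thS : forall k, th k.+1 = th k / (1 + al k).
Hypotheses (ga0 : 0 < ga 0%N) (be0 : 0 < be 0%N).
Hypotheses (muf0 : 0 <= muf) (mug0 : 0 <= mug) (mufL : muf <= L).
Hypotheses (a0 : 0 <= a) (b0 : 0 <= b).
Hypothesis gaE : forall k, ga k = if muf == 0 then ga 0%N * th k else muf.
Hypothesis beE : forall k, be k = if mug == 0 then be 0%N * th k else mug.
Hypothesis step : forall k,
  (L * be k * th k + 2 * be k * a ^+ 2 + 2 * ga k * b ^+ 2) * al k ^+ 2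
  = ga k * be k * th k.

Let ga_gt0 k : 0 < ga k.
Proof. by rewrite gaE; case: eqVneq => // h; rewrite ?mulr_gt0// lt_def h. Qed.

Let be_gt0 k : 0 < be k.
Proof. by rewrite beE; case: eqVneq => // h; rewrite ?mulr_gt0// lt_def h. Qed.

Let L0 : 0 <= L. Proof. exact: le_trans mufL. Qed.

Let wf k := Num.sqrt (L / ga k).
Let wa k := Num.sqrt 2 * a / Num.sqrt (ga k * th k).
Let wb k := Num.sqrt 2 * b / Num.sqrt (be k * th k).

Let step_ge1 k : 1 <= al k * wf k + al k * wa k + al k * wb k.
Proof.
have t0 := th_gt0 k; have g0 := ga_gt0 k; have e0 := be_gt0 k.
apply: sum3_ge1; do ?by rewrite mulr_ge0 ?divr_ge0 ?mulr_ge0 ?sqrtr_ge0 ?(ltW (al0 k)).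
rewrite /wf /wa /wb !exprMn !exprVn !sqr_sqrtr ?(divr_ge0, mulr_ge0)
  ?(ltW g0) ?(ltW e0) ?(ltW t0)//.
(* After multiplication by [ga k * be k * th k] the claim is the step-size rule. *)
apply: (mulIf (x := ga k * be k * th k)); first by rewrite !mulf_neq0 ?gt_eqF.
rewrite mul1r -[RHS]step; field.
by rewrite !gt_eqF.
Qed.

(** For [muf = 0], [ga] is proportional to [th], so [wf] and [wa] grow like [th^(-1/2)] and
    [th^(-1)]; for [muf > 0], [ga] is constant and they grow like 1 and [th^(-1/2)]. Each summand is
    the function of [th] with matching increments. *)
Definition potential_f k : R :=
  if muf == 0 then 3 * Num.sqrt (L / ga 0%N) / Num.sqrt (th k)
                   + Num.sqrt 2 * a / Num.sqrt (ga 0%N) / th k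
  else 2 * Num.sqrt (L / muf) * - ln (th k)
       + 3 * (Num.sqrt 2 * a) / Num.sqrt muf / Num.sqrt (th k).

Definition potential_g k : R :=
  if mug == 0 then Num.sqrt 2 * b / Num.sqrt (be 0%N) / th k
  else 3 * (Num.sqrt 2 * b) / Num.sqrt mug / Num.sqrt (th k).

Lemma potential_f_step k :
  al k * wf k + al k * wa k <= potential_f k.+1 - potential_f k.
Proof.
have t0 := th_gt0 k; have g0 := ga0.
have i1 := invr_increment (al0 k) t0.
have i2 := invr_sqrt_increment (al0 k) (al1 k) t0.
have i3 := ln_increment (al0 k) (al1 k) t0.
rewrite /wf /wa /potential_f thS gaE; case: eqVneq => h.
- have -> : Num.sqrt (L / (ga 0%N * th k)) = Num.sqrt (L / ga 0%N) / Num.sqrt (th k).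
    by rewrite invfM mulrA sqrtrM ?divr_ge0 ?(ltW g0)// sqrtrV ?(ltW t0).
  rewrite sqrt_mulrr ?(ltW g0) ?(ltW t0)//.
  have := ler_wpM2l (sqrtr_ge0 (L / ga 0%N)) i2.
  have := congr1 ( *%R (Num.sqrt 2 * a / Num.sqrt (ga 0%N))) i1.
  rewrite invfM; lra.
- rewrite [Num.sqrt (muf * _)]sqrtrM// invfM.
  have := ler_wpM2l (sqrtr_ge0 (L / muf)) i3.
  have : 0 <= Num.sqrt 2 * a / Num.sqrt muf by rewrite divr_ge0 ?mulr_ge0 ?sqrtr_ge0.
  move=> /ler_wpM2l /(_ _ _ i2); lra.
Qed.

Lemma potential_g_step k : al k * wb k <= potential_g k.+1 - potential_g k.
Proof.
have t0 := th_gt0 k; have e0 := be0.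
have i1 := invr_increment (al0 k) t0.
have i2 := invr_sqrt_increment (al0 k) (al1 k) t0.
rewrite /wb /potential_g thS beE; case: eqVneq => h.
- rewrite sqrt_mulrr ?(ltW e0) ?(ltW t0)//.
  have := congr1 ( *%R (Num.sqrt 2 * b / Num.sqrt (be 0%N))) i1.
  rewrite invfM; lra.
- rewrite sqrtrM// invfM.
  have : 0 <= Num.sqrt 2 * b / Num.sqrt mug by rewrite divr_ge0 ?mulr_ge0 ?sqrtr_ge0.
  move=> /ler_wpM2l /(_ _ _ i2); lra.
Qed.

Lemma le_potential k : k%:R <= potential_f k + potential_g k.
Proof.
apply: (@natr_le_of_increments R (fun k => potential_f k + potential_g k)).
  rewrite /potential_f /potential_g th0 ln1 sqrtr1 oppr0 mulr0 add0r.
  by case: ifP; case: ifP; rewrite ?addr_ge0 ?divr_ge0 ?mulr_ge0 ?sqrtr_ge0.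
move=> j; have := step_ge1 j; have := potential_f_step j.
have := potential_g_step j; lra.
Qed.


(** The branch of the minimum in [rate] that fits the behaviour of [ga]; [min_rate_f] passes from it
    to the minimum. *)
Definition rate_f (k : nat) : R :=
  if muf == 0 then a / (Num.sqrt (ga 0%N) * k%:R) + L / (ga 0%N * k%:R ^+ 2)
  else a ^+ 2 / (muf * k%:R ^+ 2) + expR (- (k%:R / 4 * Num.sqrt (muf / L))).

Definition rate_g (k : nat) : R :=
  if mug == 0 then b / (Num.sqrt (be 0%N) * k%:R)
  else b ^+ 2 / (mug * k%:R ^+ 2).

Lemma rate_f_ge0 k : 0 <= rate_f k.
Proof.
rewrite /rate_f; case: ifP => _; apply: addr_ge0; rewrite ?expR_ge0//;
by rewrite divr_ge0 ?mulr_ge0 ?sqrtr_ge0 ?sqr_ge0 ?ler0n ?(ltW ga0).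
Qed.

Lemma rate_g_ge0 k : 0 <= rate_g k.
Proof.
by rewrite /rate_g; case: ifP => _;
  rewrite divr_ge0 ?mulr_ge0 ?sqrtr_ge0 ?sqr_ge0 ?ler0n.
Qed.

Lemma decay_g k : (0 < k)%N -> k%:R / 4 <= potential_g k ->
  th k <= 288 * rate_g k.
Proof.
move=> k0; rewrite /potential_g /rate_g; case: eqVneq => h.
  exact: decay_inv.
by apply: decay_sqrt => //; rewrite lt_def h.
Qed.

(** Either the [a] term takes [k / 4] or the [L] term takes [k / 2]. The exponential uses that half;
    for [muf = 0] a quarter suffices. *)
Lemma decay_f k : (0 < k)%N -> 3 * k%:R / 4 <= potential_f k ->
  th k <= 288 * rate_f k.
Proof.
move=> k0; have kr : 0 < k%:R :> R by rewrite ltr0n.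
have t0 := th_gt0 k.
rewrite /potential_f /rate_f; case: eqVneq => h.
  set F1 := (X in _ <= X + _ -> _); set F2 := (X in _ <= _ + X -> _) => F12.
  have r1 : 0 <= a / (Num.sqrt (ga 0%N) * k%:R).
    by rewrite divr_ge0// mulr_ge0 ?sqrtr_ge0// ltW.
  have r2 : 0 <= L / (ga 0%N * k%:R ^+ 2).
    by rewrite divr_ge0// mulr_ge0 ?sqr_ge0// ltW.
  have [le2|lt2] := leP (k%:R / 4) F2.
    by have := decay_inv a0 ga0 t0 k0 le2; lra.
  have le1 : k%:R / 4 <= F1 by lra.
  have := le_of_invr_sqrt t0 kr le1.
  rewrite exprMn sqr_sqrtr ?divr_ge0 ?(ltW ga0)//.
  have -> : 3 ^+ 2 * (L / ga 0%N) / k%:R ^+ 2 = 9 * (L / (ga 0%N * k%:R ^+ 2)).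
    by field; rewrite !gt_eqF.
  lra.
have m0 : 0 < muf by rewrite lt_def h.
have Lp : 0 < L by exact: lt_le_trans mufL.
set F1 := (X in _ <= X + _ -> _); set F2 := (X in _ <= _ + X -> _) => F12.
have r1 : 0 <= a ^+ 2 / (muf * k%:R ^+ 2).
  by rewrite divr_ge0 ?mulr_ge0 ?sqr_ge0.
have r2 := expR_ge0 (- (k%:R / 4 * Num.sqrt (muf / L))).
have [le2|lt2] := leP (k%:R / 4) F2.
  by have := decay_sqrt a0 m0 t0 k0 le2; lra.
have le1 : k%:R / 2 <= F1 by lra.
have sp : 0 < Num.sqrt (L / muf) by rewrite sqrtr_gt0 divr_gt0.
have := le_expR_of_ln sp t0 le1.
have -> : (Num.sqrt (L / muf))^-1 = Num.sqrt (muf / L).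
  by rewrite -sqrtrV ?invf_div// divr_ge0// ltW.
lra.
Qed.

Lemma theta_decay k : (0 < k)%N -> th k <= 288 * (rate_g k + rate_f k).
Proof.
move=> k0; have := le_potential k.
have := rate_f_ge0 k; have := rate_g_ge0 k.
have [/(decay_g k0)|lt_g] := leP (k%:R / 4) (potential_g k); first lra.
have [/(decay_f k0)|lt_f] := leP (3 * k%:R / 4) (potential_f k); lra.
Qed.

Hypothesis ga_muf : muf != 0 -> ga 0%N = muf.
Hypothesis be_mug : mug != 0 -> be 0%N = mug.

(* For [mug > 0] both arguments of the minimum are powers of one quantity, and
   [theta <= 1] makes the weaker of the two bounds a consequence of the other. *)
Lemma min_rate_g k : (0 < k)%N ->
  exists t, [/\ Order.min (b / (Num.sqrt (be 0%N) * k%:R))%:E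
                  (div_oo (b ^+ 2) (mug * k%:R ^+ 2)) = t%:E,
                0 <= t & rate_g k <= t \/ 1 <= t].
Proof.
move=> k0; have kr : 0 < k%:R :> R by rewrite ltr0n.
have := rate_g_ge0 k; rewrite /rate_g /div_oo; case: eqVneq => [->|h] r0.
  rewrite mul0r eqxx min_l ?leey//.
  by exists (b / (Num.sqrt (be 0%N) * k%:R)); split => //; left.
rewrite mulf_eq0 (negbTE h) expf_eq0/= (gt_eqF kr) -EFin_min.
rewrite be_mug//; set s := b / _.
have s0 : 0 <= s by rewrite divr_ge0 ?mulr_ge0 ?sqrtr_ge0 ?(ltW kr).
have -> : b ^+ 2 / (mug * k%:R ^+ 2) = s ^+ 2.
  by rewrite /s exprMn exprVn exprMn sqr_sqrtr.
exists (Num.min s (s ^+ 2)); split => //; first by rewrite le_min s0 sqr_ge0.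
have [/ltW s1|s1] := ltP s 1; [left|right]; rewrite le_min ?lexx ?andbT ?s1/=.
  by rewrite expr2 ler_piMr.
by rewrite exprn_ege1.
Qed.

(** For [muf > 0] the two arguments are [s + l] and [s^2 + e]. If [s + l] is the minimum and
    [s < 1], then [s^2 <= s] and [e <= 32 l]; if [s >= 1], the bound will follow from
    [theta <= 1]. *)
Lemma min_rate_f k : (0 < k)%N ->
  exists t, [/\ Order.min
                  (a / (Num.sqrt (ga 0%N) * k%:R) + L / (ga 0%N * k%:R ^+ 2))%:E
                  (div_oo (a ^+ 2) (muf * k%:R ^+ 2)
                   + (expR (- (k%:R / 4 * Num.sqrt (muf / L))))%:E)%E = t%:E,
                0 <= t & rate_f k <= 32 * t \/ 1 <= t].
Proof.
move=> k0; have kr : 0 < k%:R :> R by rewrite ltr0n.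
have := rate_f_ge0 k; rewrite /rate_f /div_oo; case: eqVneq => [->|h].
  rewrite mul0r eqxx min_l ?leey//; set t := _ + _ => t0.
  by exists t; split => //; left; lra.
rewrite mulf_eq0 (negbTE h) expf_eq0/= (gt_eqF kr) -EFinD -EFin_min.
rewrite ga_muf//; set s := a / _; set e := expR _; set l := L / _.
have m0 : 0 < muf by rewrite lt_def h.
have Lp : 0 < L by exact: lt_le_trans mufL.
have s0 : 0 <= s by rewrite divr_ge0 ?mulr_ge0 ?sqrtr_ge0 ?(ltW kr).
have l0 : 0 <= l by rewrite divr_ge0 ?mulr_ge0 ?sqr_ge0.
have e0 : 0 <= e := expR_ge0 _.
have -> : a ^+ 2 / (muf * k%:R ^+ 2) = s ^+ 2.
  by rewrite /s exprMn exprVn exprMn sqr_sqrtr.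
(* [expR (- z / 4) <= 32 / z ^ 2] *)
have el : e <= 32 * l.
  have /expRN_le : 0 < k%:R / 4 * Num.sqrt (muf / L).
    by rewrite mulr_gt0 ?divr_gt0 ?sqrtr_gt0 ?divr_gt0.
  move=> /le_trans; apply; rewrite exprMn sqr_sqrtr ?divr_ge0//.
  rewrite le_eqVlt; apply/orP; left; apply/eqP; rewrite /l; field.
  by rewrite !gt_eqF.
move=> r0; exists (Num.min (s + l) (s ^+ 2 + e)); split => //.
  by rewrite le_min addr_ge0//= addr_ge0 ?sqr_ge0.
have [le_|lt_] := leP (s + l) (s ^+ 2 + e); last by left; lra.
have [/ltW s1|s1] := ltP s 1; [left|right]; last lra.
have : s ^+ 2 <= s by rewrite expr2 ler_piMr.
lra.
Qed.

Lemma theta_le_rate k : (0 < k)%N -> th k <= 1 ->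
  ((th k)%:E <= (288 * 32)%:E * rate a b L muf mug (ga 0%N) (be 0%N) k)%E.
Proof.
move=> k0 t1; rewrite /rate.
have [p [-> p0 rp]] := min_rate_g k0.
have [q [-> q0 rq]] := min_rate_f k0.
rewrite -EFinD -EFinM lee_fin.
have := theta_decay k0; case: rp; case: rq; lra.
Qed.

End Rate.

(** * Recursions for the parameters and the bound on the step sizes *)

Section Relaxation.
Context {R : realType}.
Variables (muf mug : R) (al th ga be : nat -> R).
Hypothesis par : parameters muf mug al th ga be.
Hypotheses (muf0 : 0 <= muf) (mug0 : 0 <= mug).

Lemma alpha_gt0 k : 0 < al k. Proof. by case: par. Qed.

Let al1_neq0 k : 1 + al k != 0.
Proof. by rewrite gt_eqF// addr_gt0 ?alpha_gt0. Qed.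

Lemma thetaS k : th k.+1 = th k / (1 + al k).
Proof.
case: par => _ _ _ _ /(_ k)[e _ _]; apply: (canRL (mulfK (al1_neq0 k))).
have : th k.+1 - th k = - th k.+1 * al k by rewrite -e divfK// gt_eqF ?alpha_gt0.
lra.
Qed.

Lemma relaxation_step (mu c c' a : R) : 0 < a -> (c' - c) / a = mu - c' ->
  (1 + a) * c' = c + mu * a.
Proof.
move=> a0 e; have : c' - c = (mu - c') * a by rewrite -e divfK// gt_eqF.
lra.
Qed.

Lemma gammaS k : (1 + al k) * ga k.+1 = ga k + muf * al k.
Proof. by case: par => _ _ _ a0 /(_ k)[_ e _]; exact: relaxation_step. Qed.

Lemma betaS k : (1 + al k) * be k.+1 = be k + mug * al k.
Proof. by case: par => _ _ _ a0 /(_ k)[_ _ e]; exact: relaxation_step. Qed.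

Lemma theta_gt0 k : 0 < th k.
Proof.
elim: k => [|k IH]; first by case: par => ->.
by rewrite thetaS divr_gt0// addr_gt0 ?alpha_gt0.
Qed.

Lemma theta_le1 k : th k <= 1.
Proof.
elim: k => [|k IH]; first by case: par => ->.
rewrite thetaS ler_pdivrMr ?addr_gt0 ?alpha_gt0//.
by have := alpha_gt0 k; lra.
Qed.

Lemma relaxation_gt0 (mu : R) (c : nat -> R) : 0 <= mu -> 0 < c 0%N ->
  (forall k, (1 + al k) * c k.+1 = c k + mu * al k) -> forall k, 0 < c k.
Proof.
move=> mu0 c0 cS; elim=> [//|k IH].
rewrite -(pmulr_rgt0 _ (addr_gt0 ltr01 (alpha_gt0 k))) cS ltr_wpDr//.
by rewrite mulr_ge0// ltW ?alpha_gt0.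
Qed.

(** Started at [mu] the recursion is stationary, and for [mu = 0] it is that of [theta]. *)
Lemma relaxationE (mu : R) (c : nat -> R) : (mu != 0 -> c 0%N = mu) ->
  (forall k, (1 + al k) * c k.+1 = c k + mu * al k) ->
  forall k, c k = if mu == 0 then c 0%N * th k else mu.
Proof.
move=> c0 cS; elim=> [|k IH].
  by case: par => -> _ _ _ _; rewrite mulr1; case: eqVneq.
apply: (mulfI (al1_neq0 k)); rewrite cS {}IH; case: eqVneq => [->|h].
  by rewrite mul0r addr0 thetaS mulrCA [_ * (_ / _)]mulrCA divff// mulr1.
by ring.
Qed.

Lemma gamma_gt0 k : 0 < ga k.
Proof. by apply: (relaxation_gt0 muf0) gammaS k => //; case: par. Qed.

Lemma beta_gt0 k : 0 < be k.
Proof. by apply: (relaxation_gt0 mug0) betaS k => //; case: par. Qed.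

(** By the step-size rule the initial condition says that [al 0 <= 1]. It propagates because [ga],
    [be] and [th] never exceed their initial values. *)
Lemma alpha_le1 (L a b : R) :
  (muf != 0 -> ga 0%N = muf) -> (mug != 0 -> be 0%N = mug) -> 0 <= L ->
  (forall k, (L * be k * th k + 2 * be k * a ^+ 2 + 2 * ga k * b ^+ 2)
               * al k ^+ 2 = ga k * be k * th k) ->
  ga 0%N * be 0%N <= L * be 0%N + 2 * be 0%N * a ^+ 2 + 2 * ga 0%N * b ^+ 2 ->
  forall k, al k <= 1.
Proof.
move=> gamuf bemug L0 step init k.
have g0 := gamma_gt0 k; have e0 := beta_gt0 k; have t0 := theta_gt0 k.
have t1 := theta_le1 k; have a0 := alpha_gt0 k.
have gale : ga k <= ga 0%N.
  rewrite (relaxationE gamuf gammaS k); case: eqVneq => h.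
    by rewrite ler_piMr// ltW// gamma_gt0.
  by rewrite gamuf.
have bele : be k <= be 0%N.
  rewrite (relaxationE bemug betaS k); case: eqVneq => h.
    by rewrite ler_piMr// ltW// beta_gt0.
  by rewrite bemug.
suff le_ : ga k * be k * th k
    <= L * be k * th k + 2 * be k * a ^+ 2 + 2 * ga k * b ^+ 2.
  rewrite leNgt; apply/negP => al1.
  have D0 := mulr_gt0 (mulr_gt0 g0 e0) t0.
  have : 1 < al k ^+ 2 by rewrite exprn_egt1.
  have := step k; nra.
have G0 := gamma_gt0 0; have B0 := beta_gt0 0.
(* Dividing by [ga k * be k], each term of the right-hand side grows with [k]. *)
have {}init : 1 <= L / ga 0%N + 2 * a ^+ 2 / ga 0%N + 2 * b ^+ 2 / be 0%N.
  rewrite -(ler_pM2l (mulr_gt0 G0 B0)) mulr1; apply: le_trans init _.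
  by rewrite le_eqVlt; apply/orP; left; apply/eqP; field; rewrite !gt_eqF.
have -> : L * be k * th k + 2 * be k * a ^+ 2 + 2 * ga k * b ^+ 2
    = ga k * be k * (L / ga k * th k + 2 * a ^+ 2 / ga k + 2 * b ^+ 2 / be k).
  by field; rewrite !gt_eqF.
rewrite ler_pM2l ?mulr_gt0//.
have i1 : L / ga 0%N <= L / ga k by apply: ler_wpM2l => //; rewrite lef_pV2.
have i2 : 2 * a ^+ 2 / ga 0%N <= 2 * a ^+ 2 / ga k.
  by apply: ler_wpM2l; [rewrite mulr_ge0 ?sqr_ge0|rewrite lef_pV2].
have i3 : 2 * b ^+ 2 / be 0%N <= 2 * b ^+ 2 / be k.
  by apply: ler_wpM2l; [rewrite mulr_ge0 ?sqr_ge0|rewrite lef_pV2].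
have n1 : 0 <= L / ga k by rewrite divr_ge0// ltW.
have n2 : 0 <= 2 * a ^+ 2 / ga k.
  by rewrite divr_ge0 ?(ltW g0)// mulr_ge0 ?sqr_ge0.
have n3 : 0 <= 2 * b ^+ 2 / be k.
  by rewrite divr_ge0 ?(ltW e0)// mulr_ge0 ?sqr_ge0.
nra.
Qed.

End Relaxation.

(** * Equivalence of the scheme and the algorithm *)

Section Equivalence.
Context {R : realType} {m n r : nat}.
Variables (X : set 'cV[R]_m) (Y : set 'cV[R]_n).
Variables (A : 'M[R]_(r, m)) (B : 'M[R]_(r, n)) (b : 'cV[R]_r).
Variables (f1 f2 : 'cV[R]_m -> \bar R) (g : 'cV[R]_n -> \bar R).
Variables (muf mug : R) (al th ga be : nat -> R).
Variables (u v x : nat -> 'cV[R]_m) (y w : nat -> 'cV[R]_n).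
Variables (lam lbar : nat -> 'cV[R]_r).
Hypotheses (muf0 : 0 <= muf) (mug0 : 0 <= mug).
Hypothesis par : parameters muf mug al th ga be.

Lemma eta_f_gt0 k : 0 < eta_f muf al ga k.
Proof.
rewrite /eta_f ltr_wpDr ?(gamma_gt0 par)// mulr_ge0//.
by rewrite ltW// (alpha_gt0 par).
Qed.

Lemma eta_g_gt0 k : 0 < eta_g mug al be k.
Proof.
have a0 := alpha_gt0 par k.
rewrite /eta_g ltr_wpDr ?mulr_gt0 ?addr_gt0 ?(beta_gt0 par)//.
by rewrite mulr_ge0// ltW.
Qed.

Lemma scheme_H_algorithm :
  scheme_H X Y A B b f1 f2 g muf mug al th ga be u v x y w lam lbar /\
    lbar_choice A B b al th v w lam lbar <->
  algorithm X Y A B b f1 f2 g muf mug al th ga be u v x y w lam lbar.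
Proof.
have proxv k z : argmin X (fun z => f2 z
      + (dot (grad f1 (u k) + A^T *m lbar k.+1) z)%:E
      + (eta_f muf al ga k / (2 * al k)
           * enorm (z - v_tilde muf al ga u v k) ^+ 2)%:E)%E z
    <-> prox X (al k / eta_f muf al ga k) f2
          (v_tilde muf al ga u v k - (al k / eta_f muf al ga k)
             *: (grad f1 (u k) + A^T *m lbar k.+1)) z.
  have a0 := alpha_gt0 par k; have e0 := eta_f_gt0 k.
  apply: argmin_prox => //; first exact: divr_gt0.
  by field; rewrite !gt_eqF.
have proxy k z : argmin Y (fun z => g z + (dot (B *m z) (lbar k.+1))%:E
      + (eta_g mug al be k / (2 * al k ^+ 2)
           * enorm (z - y_tilde mug al be y w k) ^+ 2)%:E)%E z
    <-> prox Y (al k ^+ 2 / eta_g mug al be k) g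
          (y_tilde mug al be y w k - (al k ^+ 2 / eta_g mug al be k)
             *: (B^T *m lbar k.+1)) z.
  have a0 := alpha_gt0 par k; have e0 := eta_g_gt0 k.
  apply: argmin_prox => [||z']; first by rewrite divr_gt0// exprn_gt0.
    by field; rewrite !gt_eqF.
  by rewrite dot_mulmxl dotC.
split=> [[[X0 V0 H] lb]|[X0 V0 lb H]].
  by split=> // k; have [[uE /proxv vE xE] /proxy yE wE lE] := H k.
by do 2!split=> //; move=> k; have [[uE /proxv vE xE] /proxy yE wE lE] := H k.
Qed.

End Equivalence.

Arguments scheme_H_algorithm {R m n r X Y A B b f1 f2 g muf mug al th ga be
  u v x y w lam lbar}.

(** * Convergence *)

Section Convergence.
Context {R : realType} {m n r : nat}.
Variables (X : set 'cV[R]_m) (Y : set 'cV[R]_n).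
Variables (A : 'M[R]_(r, m)) (B : 'M[R]_(r, n)) (b : 'cV[R]_r).
Variables (f f1 f2 : 'cV[R]_m -> \bar R) (g : 'cV[R]_n -> \bar R).
Variables (L muf mug : R) (al th ga be : nat -> R).
Variables (u v x : nat -> 'cV[R]_m) (y w : nat -> 'cV[R]_n).
Variables (lam lbar : nat -> 'cV[R]_r).
Variables (xs : 'cV[R]_m) (ys : 'cV[R]_n) (ls : 'cV[R]_r).
Hypotheses (cX : convex_set X) (cY : convex_set Y).
Hypothesis saddle : saddle_point X Y A B b f g xs ys ls.
Hypotheses (muf0 : 0 <= muf) (mug0 : 0 <= mug) (mufL : muf <= L).
Hypothesis par : parameters muf mug al th ga be.
Hypothesis alg :
  algorithm X Y A B b f1 f2 g muf mug al th ga be u v x y w lam lbar.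
Hypothesis fE : forall z, f z = (f1 z + f2 z)%E.
Hypotheses (S0g : class_S0 mug Y g) (S0f2 : class_S0 0 X f2).
Hypothesis S11f1 : class_S11 muf L X f1.
Hypothesis step : forall k,
  (L * be k * th k + 2 * be k * opnorm A ^+ 2 + 2 * ga k * opnorm B ^+ 2)
    * al k ^+ 2 = ga k * be k * th k.

Let al0 k : 0 < al k := alpha_gt0 par k.
Let th0 k : 0 < th k := theta_gt0 par k.
Let ga0 k : 0 < ga k := gamma_gt0 par muf0 k.
Let be0 k : 0 < be k := beta_gt0 par mug0 k.
Let L0 : 0 <= L := le_trans muf0 mufL.

Let sch : scheme_H X Y A B b f1 f2 g muf mug al th ga be u v x y w lam lbar.
Proof. by have [] := (scheme_H_algorithm muf0 mug0 par).2 alg. Qed.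

Let xE k : x k.+1 = (1 + al k)^-1 *: (x k + al k *: v k.+1).
Proof. by case: sch => _ _ /(_ k)[[]]. Qed.

Let yE k : y k.+1 = (1 + al k)^-1 *: (y k + al k *: w k.+1).
Proof.
have [_ _ /(_ k)[_ _ -> _]] := sch; apply/matrixP => i j; rewrite !mxE; field.
by rewrite !gt_eqF ?addr_gt0.
Qed.

Let f1Ny z : f1 z != -oo%E. Proof. by case: S11f1 => [[[[]]]]. Qed.
Let f2Ny z : f2 z != -oo%E. Proof. by case: S0f2 => [[[]]]. Qed.
Let gNy z : g z != -oo%E. Proof. by case: S0g => [[[]]]. Qed.

Let Xv k : X (v k).
Proof. by case: sch => _ ? H; case: k => // k; have [[_ []]] := H k. Qed.

Let Xx k : X (x k).
Proof.
elim: k => [|k IH]; first by case: sch.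
by rewrite xE; apply: convex_set_avg => //; exact: ltW.
Qed.

Let Xu k : X (u k).
Proof.
have [_ _ /(_ k)[[-> _ _] _ _ _]] := sch.
by apply: convex_set_avg => //; exact: ltW.
Qed.

(** The shift matters: unlike [x 0] and [v 0] in [X], [y 0] is not assumed to lie in [Y]. *)
Let YyS k : Y (y k.+1).
Proof. by have [_ _ /(_ k)[_ []]] := sch. Qed.

Lemma iterates_feasible k : (1 <= k)%N -> X (x k) /\ Y (y k).
Proof. by case: k => // k _; split. Qed.

Let f1_fin z : X z -> f1 z \is a fin_num.
Proof. by move=> Xz; case: S11f1 => _ /(_ _ Xz)[/nbhs_singleton]. Qed.

Let f2v_fin k : f2 (v k.+1) \is a fin_num.
Proof.
have [_ _ /(_ k)[[_ vmin _] _ _ _]] := sch; move: vmin.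
under eq_fun do rewrite -addeA -EFinD.
exact: argmin_fin.
Qed.

Let gy_fin k : g (y k.+1) \is a fin_num.
Proof.
have [_ _ /(_ k)[_ ymin _ _]] := sch; move: ymin.
under eq_fun do rewrite -addeA -EFinD.
exact: argmin_fin.
Qed.

Let f_fin z : X z -> f2 z \is a fin_num -> f z \is a fin_num.
Proof. by move=> Xz f2z; rewrite fE fin_numD f1_fin. Qed.

Let lagrangianE z t l : X z -> Y t -> lagrangian X Y A B b f g z t l
  = (f z + g t + (dot l (A *m z + B *m t - b))%:E)%E.
Proof.
move=> Xz Yt; rewrite /lagrangian /objective /indicator.
by rewrite mem_set ?adde0.
Qed.

Let Xs : X xs. Proof. by case: saddle. Qed.
Let Ys : Y ys. Proof. by case: saddle. Qed.

Let fNy z : f z != -oo%E.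
Proof. by rewrite fE adde_eq_ninfty negb_or f1Ny f2Ny. Qed.

(* The value at the saddle point is finite because it is at most the value at
   [(v 1, y 1)], where [argmin] requires finiteness. *)
Let fgs_fin : f xs \is a fin_num /\ g ys \is a fin_num.
Proof.
have [_ _ /(_ (v 1%N) (y 1%N) ls)[_]] := saddle.
rewrite !lagrangianE//.
have /fineK <- := f_fin (Xv 1) (f2v_fin 0).
have /fineK <- := gy_fin 0.
move: (fNy xs) (gNy ys); rewrite -!EFinD.
by case: (f xs) => //; case: (g ys).
Qed.

Let fs_fin : f xs \is a fin_num. Proof. by case: fgs_fin. Qed.
Let gs_fin : g ys \is a fin_num. Proof. by case: fgs_fin. Qed.

Let f2s_fin : f2 xs \is a fin_num.
Proof. by have := fs_fin; rewrite fE fin_numD => /andP[]. Qed.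

Let feas : A *m xs + B *m ys = b.
Proof.
set c := A *m xs + B *m ys - b.
suff : c = 0 by move/eqP; rewrite subr_eq0 => /eqP.
(* The saddle inequality at the multiplier [ls + c] reduces to [|c|^2 <= 0]. *)
have [_ _ /(_ xs ys (ls + c))[+ _]] := saddle.
rewrite !lagrangianE// -(fineK fs_fin) -(fineK gs_fin) -!EFinD lee_fin.
rewrite lerD2l dotDl -/c gerDl => c0.
by apply/eqP; rewrite -dot_eq0 eq_le c0 dot_ge0.
Qed.

Let Fs := fine (f xs) + fine (g ys).

Let residual k := A *m x k + B *m y k - b.

Let saddle_lower z t : X z -> Y t -> f z \is a fin_num -> g t \is a fin_num ->
  Fs <= fine (f z) + fine (g t) + dot ls (A *m z + B *m t - b).
Proof.
move=> Xz Yt fz gt; have [_ _ /(_ z t ls)[_]] := saddle.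
rewrite !lagrangianE// feas subrr dotC dot0l adde0.
by rewrite -(fineK fs_fin) -(fineK gs_fin) -(fineK fz) -(fineK gt) -!EFinD lee_fin.
Qed.

(* [lam k - residual k / th k] does not depend on [k]. *)
Lemma residualE k : residual k = th k *: (residual 0 + lam k - lam 0).
Proof.
elim: k => [|k IH]; first by case: par => -> _ _ _ _; rewrite scale1r addrK.
have [_ _ /(_ k)[_ _ _ lE]] := sch.
have a1 : 1 + al k != 0 by rewrite gt_eqF// addr_gt0.
have t1 : th k != 0 by rewrite gt_eqF.
have e : residual k.+1 = (1 + al k)^-1 *: (residual k
     + al k *: (A *m v k.+1 + B *m w k.+1 - b)).
  rewrite /residual xE yE -!scalemxAr !mulmxDr -!scalemxAr.
  by apply/matrixP => i j; rewrite !mxE; field.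
rewrite e IH lE (thetaS par).
by apply/matrixP => i j; rewrite !mxE; field; rewrite a1 t1.
Qed.

(** The Lyapunov function in real arithmetic, with [Fs] for the Lagrangian at [(xs, ys, lam k)] by
    feasibility. It is meaningful where the values are finite, since [fine] erases infinities. *)
Definition lyapunov_real k : R :=
  fine (f (x k)) + fine (g (y k)) + dot ls (residual k) - Fs
  + ga k / 2 * dot (v k - xs) (v k - xs) + be k / 2 * dot (w k - ys) (w k - ys)
  + th k / 2 * dot (lam k - ls) (lam k - ls).

Let E := lyapunov X Y A B b g th ga be v x y w lam f xs ys ls.

Let E_fin k : f (x k) \is a fin_num -> Y (y k) -> g (y k) \is a fin_num ->
  E k = (lyapunov_real k)%:E.
Proof.
move=> fx Yk gy; rewrite /E /lyapunov /lyapunov_real !enorm_sqr !lagrangianE//.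
rewrite feas subrr (dotC (lam k)) dot0l adde0.
rewrite -(fineK fs_fin) -(fineK gs_fin) -(fineK fx) -(fineK gy).
by rewrite -!EFinD.
Qed.

(** No term can be [-oo], so one infinite term makes the Lagrangian [+oo]. *)
Let E0_pinfty : ~ [/\ f2 (x 0%N) \is a fin_num, Y (y 0%N)
    & g (y 0%N) \is a fin_num] -> E 0%N = +oo%E.
Proof.
move=> nfin; rewrite /E /lyapunov.
suff -> : lagrangian X Y A B b f g (x 0) (y 0) ls = +oo%E.
  rewrite lagrangianE// -(fineK fs_fin) -(fineK gs_fin).
  by rewrite -!EFinD.
rewrite /lagrangian /objective /indicator.
have [Y0|nY0] := pselect (Y (y 0%N)); last first.
  rewrite memNset; last by case.
  move: (fNy (x 0)) (gNy (y 0)).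
  by case: (f _) => [?| |]//; case: (g _).
rewrite mem_set//= adde0.
have : ~~ ((f2 (x 0%N) \is a fin_num) && (g (y 0%N) \is a fin_num)).
  by apply/negP => /andP[? ?]; apply: nfin.
move: (f1_fin (Xx 0)) (f2Ny (x 0)) (gNy (y 0)); rewrite fE.
by case: (f1 _) => [?| |]//; case: (f2 _) => [?| |]//; case: (g _).
Qed.

(** * Estimates from a starting point of finite energy *)

Section FiniteStart.
Hypotheses (f20 : f2 (x 0%N) \is a fin_num) (Y0 : Y (y 0%N)).
Hypothesis (g0 : g (y 0%N) \is a fin_num).

Let Yy k : Y (y k). Proof. by case: k. Qed.
Let gyk_fin k : g (y k) \is a fin_num. Proof. by case: k. Qed.

(** Stated in [\bar R] because it also yields the finiteness of [f2 (x k.+1)] by induction. *)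
Let f2_convex k : f2 (x k) \is a fin_num ->
  (f2 (x k.+1) <= ((1 + al k)^-1 * (fine (f2 (x k)) + al k * fine (f2 (v k.+1))))%:E)%E.
Proof.
move=> fx; rewrite xE; have a0 := al0 k.
have [[_ _ ch] _] := S0f2.
have t01 : 0 < (1 + al k)^-1 < 1 by rewrite invr_gt0 invf_lt1 ?addr_gt0//=; lra.
have := ch (x k) (v k.+1) _ t01.
rewrite -{1}(fineK fx) -{1}(fineK (f2v_fin k)) -!EFinM -EFinD.
have e : 1 - (1 + al k)^-1 = (1 + al k)^-1 * al k by field; rewrite gt_eqF ?addr_gt0.
by rewrite e scalerDr scalerA mulrDr mulrA.
Qed.

Lemma f2x_fin k : f2 (x k) \is a fin_num.
Proof.
elim: k => // k IH; have := f2_convex IH; have := f2Ny (x k.+1).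
by case: (f2 _).
Qed.

Lemma fx_fin k : f (x k) \is a fin_num. Proof. exact/f_fin/f2x_fin. Qed.

Lemma lyapunov_real_step k :
  (1 + al k) * lyapunov_real k.+1 <= lyapunov_real k.
Proof.
have a0 := al0 k; have t0 := th0 k; have c0 := ga0 k; have e0 := be0 k.
have a1 : 0 < 1 + al k by rewrite addr_gt0.
have [_ _ /(_ k)[[uE vmin x'E] ymin w'E lam'E]] := sch.
have [_ _ lbarE _] := alg.
have [_ _ cf2] : proper_closed_convex f2 by case: S0f2.
have [_ _ cg] : proper_closed_convex g by case: S0g.
have [[[_ _ cf1] f1mu] f1diff f1smooth] := S11f1.
(* Multiplied by [be k] and [ga k] respectively, [stA] and [stB] are the step-size rule with
   nonnegative terms dropped. *)
have stA : 2 * opnorm A ^+ 2 * al k ^+ 2 <= th k * (ga k - L * al k ^+ 2).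
  rewrite -(ler_pM2l e0) -subr_ge0.
  have -> : be k * (th k * (ga k - L * al k ^+ 2))
      - be k * (2 * opnorm A ^+ 2 * al k ^+ 2)
      = 2 * ga k * opnorm B ^+ 2 * al k ^+ 2.
    by have := step k; lra.
  by rewrite !mulr_ge0 ?sqr_ge0 ?opnorm_ge0 ?(ltW a0) ?(ltW c0).
have stB : 2 * opnorm B ^+ 2 * al k ^+ 2 <= th k * be k.
  rewrite -(ler_pM2l c0) -subr_ge0.
  have -> : ga k * (th k * be k) - ga k * (2 * opnorm B ^+ 2 * al k ^+ 2)
      = L * be k * th k * al k ^+ 2 + 2 * be k * opnorm A ^+ 2 * al k ^+ 2.
    by have := step k; lra.
  by rewrite addr_ge0// !mulr_ge0 ?opnorm_ge0 ?(ltW a0) ?(ltW e0) ?(ltW t0).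
have grad_le z : X z -> fine (f1 (u k)) + dot (grad f1 (u k)) (z - u k) <= fine (f1 z).
  move=> Xz; have := gradient_inequality cf1 (f1Ny z) (f1diff _ (Xu k)).
  by rewrite -{1}(fineK (f1_fin Xz)) -{1}(fineK (f1_fin (Xu k))) -EFinD lee_fin.
have f1_up : fine (f1 (x k.+1)) - fine (f1 (u k)) - dot (grad f1 (u k)) (x k.+1 - u k)
    <= L / 2 * dot (x k.+1 - u k) (x k.+1 - u k).
  have := f1smooth _ _ (Xx k.+1) (Xu k).
  rewrite -{1}(fineK (f1_fin (Xx k.+1))) -{1}(fineK (f1_fin (Xu k))).
  by rewrite enorm_sqr -!EFinD lee_fin.
(* The gradient is a subgradient of [f1 + indicator X], the form in which [class_S0] gives strong
   convexity. *)
have f1_low : muf / 2 * dot (xs - u k) (xs - u k)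
    <= fine (f1 xs) - fine (f1 (u k)) - dot (grad f1 (u k)) (xs - u k).
  have : subdiff (fun z => f1 z + indicator X z)%E (u k) (grad f1 (u k)).
    apply: subdiff_indicator => [||//|z _]; [exact: Xu|exact/f1_fin/Xu|].
    by apply: gradient_inequality => //; exact/f1diff/Xu.
  move=> /(f1mu _ _ _ Xs (Xu k)).
  rewrite -{1}(fineK (f1_fin Xs)) -{1}(fineK (f1_fin (Xu k))).
  by rewrite enorm_sqr -!EFinD lee_fin.
have f2_cvx : (1 + al k) * fine (f2 (x k.+1))
    <= fine (f2 (x k)) + al k * fine (f2 (v k.+1)).
  have := f2_convex (f2x_fin k).
  by rewrite -(fineK (f2x_fin k.+1)) lee_fin ler_pdivlMl.
have f2_opt : fine (f2 (v k.+1))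
    + dot (- (grad f1 (u k) + A^T *m lbar k.+1)
           - ((ga k + muf * al k) / al k) *: (v k.+1 -
              (ga k + muf * al k)^-1 *: (ga k *: v k + (muf * al k) *: u k)))
          (xs - v k.+1) <= fine (f2 xs).
  have := argmin_subgradient cX f2Ny cf2 (fun=> erefl) vmin Xs.
  rewrite -{1}(fineK (f2v_fin k)) -{1}(fineK f2s_fin) -EFinD lee_fin.
  rewrite (_ : 2 * (eta_f muf al ga k / (2 * al k)) = (ga k + muf * al k) / al k)//.
  by rewrite /eta_f; field; rewrite gt_eqF.
have gsub : subdiff (fun z => g z + indicator Y z)%E (y k.+1)
    (- (B^T *m lbar k.+1) - (eta_g mug al be k / al k ^+ 2)
       *: (y k.+1 - y_tilde mug al be y w k)).
  apply: subdiff_indicator => // z Yz.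
  have lE t : dot (B *m t) (lbar k.+1) = dot (B^T *m lbar k.+1) t.
    by rewrite dot_mulmxl dotC.
  have := argmin_subgradient cY gNy cg lE ymin Yz.
  rewrite (_ : 2 * (eta_g mug al be k / (2 * al k ^+ 2))
                 = eta_g mug al be k / al k ^+ 2)//.
  by field; rewrite gt_eqF.
(* Here [y k] must lie in [Y], which for [k = 0] is the assumption [Y0]. *)
have g_low : fine (g (y k.+1)) + dot (- (B^T *m lbar k.+1)
      - (eta_g mug al be k / al k ^+ 2) *: (y k.+1 - y_tilde mug al be y w k))
      (y k - y k.+1) <= fine (g (y k)).
  case: gsub => _ /(_ (y k)); rewrite /= /indicator !mem_set// !adde0.
  by rewrite -{1}(fineK (gy_fin k)) -{1}(fineK (gyk_fin k)) -EFinD lee_fin.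
have g_strong := (S0g.2 _ _ _ Ys (YyS k) gsub).
move: g_strong; rewrite -{1}(fineK gs_fin) -{1}(fineK (gy_fin k)).
rewrite enorm_sqr -!EFinD lee_fin => g_strong.
have sx := primal_x_step a0 c0 muf0 L0 uE x'E f1_up (grad_le _ (Xx k)) f1_low
  f2_cvx f2_opt.
have sy := primal_y_step a0 e0 mug0 w'E g_low g_strong.
have := primal_dual_step ls a0 t0 feas x'E w'E (lbarE k) lam'E stA stB sx sy.
rewrite /lyapunov_real /Fs !fE !fineD ?f1_fin ?f2x_fin//.
have gaS := gammaS par k; have beS := betaS par k.
rewrite -gaS -beS.
(* With this and the recursions for [ga] and [be], every term on the left carries the factor
   [1 + al k]. *)
have -> : th k = (1 + al k) * th k.+1.
  by rewrite (thetaS par) mulrC divfK// gt_eqF.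
rewrite /residual; lra.
Qed.

Lemma lyapunov_real_le k : lyapunov_real k <= th k * lyapunov_real 0.
Proof.
elim: k => [|k IH]; first by case: par => -> _ _ _ _; rewrite mul1r.
rewrite (thetaS par) mulrAC ler_pdivlMr ?addr_gt0// mulrC.
exact: le_trans (lyapunov_real_step k) IH.
Qed.

Lemma gap_ge0 k : 0 <= fine (f (x k)) + fine (g (y k)) + dot ls (residual k) - Fs.
Proof. by rewrite subr_ge0; apply: saddle_lower => //; exact: fx_fin. Qed.

Lemma lyapunov_real_ge k :
  fine (f (x k)) + fine (g (y k)) + dot ls (residual k) - Fs
  + th k / 2 * dot (lam k - ls) (lam k - ls) <= lyapunov_real k.
Proof.
rewrite /lyapunov_real lerD2r -[leRHS]addrA lerDl.
by rewrite addr_ge0// mulr_ge0 ?dot_ge0// divr_ge0// ltW.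
Qed.

Lemma lyapunov_real_ge0 k : 0 <= lyapunov_real k.
Proof.
apply: le_trans (lyapunov_real_ge k).
by rewrite addr_ge0 ?gap_ge0// mulr_ge0 ?dot_ge0// divr_ge0// ltW.
Qed.

(** [th k / 2 * |lam k - ls|^2 <= lyapunov_real k <= th k * lyapunov_real 0], and [th k] cancels. *)
Lemma enorm_lam_le k : enorm (lam k - ls) <= Num.sqrt (2 * lyapunov_real 0).
Proof.
rewrite -[leLHS](ger0_norm (enorm_ge0 _)) -sqrtr_sqr ler_wsqrtr// enorm_sqr.
rewrite -(ler_pM2l (th0 k)).
have := lyapunov_real_ge k; have := gap_ge0 k; have := lyapunov_real_le k.
lra.
Qed.

Let R0 := Num.sqrt (2 * lyapunov_real 0) + enorm (lam 0%N - ls)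
          + enorm (residual 0).

(** By [residualE], [residual k / th k] is [residual 0 + lam k - lam 0]; passing through [ls] brings
    in the bound on the multipliers. *)
Lemma residual_le k : enorm (residual k) <= th k * R0.
Proof.
rewrite residualE enormZ gtr0_norm// ler_pM2l//.
have -> : residual 0 + lam k - lam 0%N
    = residual 0 + (lam k - ls) - (lam 0%N - ls).
  by rewrite opprB addrA addrA subrK.
apply: le_trans (ler_enormD _ _) _; rewrite enormN.
have := ler_enormD (residual 0) (lam k - ls); have := enorm_lam_le k.
rewrite /R0; lra.
Qed.

(** The Lagrangian gap differs from the objective gap by [dot ls (residual k)], and lies between 0
    and [th k * lyapunov_real 0]. *)
Lemma objective_le k : `|fine (f (x k)) + fine (g (y k)) - Fs|
  <= th k * (lyapunov_real 0 + enorm ls * R0).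
Proof.
have := ler_wpM2l (enorm_ge0 ls) (residual_le k).
have := normr_dot_le ls (residual k); rewrite ler_norml => /andP[d1 d2].
have := gap_ge0 k; have := lyapunov_real_le k; have := lyapunov_real_ge k.
have := lyapunov_real_ge0 0.
have := mulr_ge0 (ltW (divr_gt0 (th0 k) (ltr0Sn R 1))) (dot_ge0 (lam k - ls)).
have : 0 <= th k * lyapunov_real 0 by rewrite mulr_ge0 ?lyapunov_real_ge0 ?ltW.
by rewrite ler_norml => *; apply/andP; split; lra.
Qed.

End FiniteStart.


(* The starting point may have infinite energy ([f2 (x 0) = +oo], [y 0] outside
   [Y], or [g (y 0) = +oo]), and then all the bounds are trivial. *)
Lemma lyapunov_cases : E 0%N = +oo%E \/
  [/\ f2 (x 0%N) \is a fin_num, Y (y 0%N) & g (y 0%N) \is a fin_num].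
Proof.
have [fin|nfin] := pselect [/\ f2 (x 0%N) \is a fin_num, Y (y 0%N)
    & g (y 0%N) \is a fin_num]; [by right|left; exact: E0_pinfty].
Qed.

Lemma lyapunov_le k : (E k <= (th k)%:E * E 0%N)%E.
Proof.
have [->|[f20 Y0 g0]] := lyapunov_cases; first by rewrite gt0_muley ?lte_fin ?leey.
rewrite (@E_fin 0)//; last exact: f_fin.
rewrite (@E_fin k); [|exact/f_fin/f2x_fin|by case: k|by case: k].
by rewrite -EFinM lee_fin lyapunov_real_le.
Qed.

Let R0 : \bar R := (sqrte (2%:E * E 0%N) + (enorm (lam 0%N - ls))%:E
           + (enorm (residual 0))%:E)%E.

Lemma residual_bound k : ((enorm (residual k))%:E <= (th k)%:E * R0)%E.
Proof.
rewrite /R0; have [->|[f20 Y0 g0]] := lyapunov_cases.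
  by rewrite gt0_muley ?lte_fin//= gt0_muley ?lte_fin ?leey.
rewrite (@E_fin 0)//; last exact: f_fin.
by rewrite -EFinM /= lee_fin residual_le.
Qed.

Lemma objective_bound k :
  (`|objective f g (x k) (y k) - objective f g xs ys|
     <= (th k)%:E * (E 0%N + (enorm ls)%:E * R0))%E.
Proof.
have R0_ge0 : (0 <= (enorm ls)%:E * R0)%E.
  by rewrite mule_ge0 ?adde_ge0 ?sqrte_ge0 ?lee_fin ?enorm_ge0.
have [E0y|[f20 Y0 g0]] := lyapunov_cases.
  rewrite E0y addye ?gt0_muley ?lte_fin ?leey//.
  by rewrite gt_eqF// (lt_le_trans ltNy0).
rewrite /R0.
rewrite (@E_fin 0)//; last exact: f_fin.
rewrite /objective -(fineK fs_fin) -(fineK gs_fin).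
rewrite -(fineK (fx_fin f20 k)) -[g (y k)]fineK; last by case: k.
by rewrite -EFinM /= lee_fin objective_le.
Qed.

Lemma theta_bound k :
  (0 < muf -> ga 0%N = muf) -> (0 < mug -> be 0%N = mug) ->
  ga 0%N * be 0%N <= L * be 0%N + 2 * be 0%N * opnorm A ^+ 2
                     + 2 * ga 0%N * opnorm B ^+ 2 ->
  (1 <= k)%N ->
  ((th k)%:E <= (288 * 32)%:E
     * rate (opnorm A) (opnorm B) L muf mug (ga 0%N) (be 0%N) k)%E.
Proof.
move=> gamuf bemug init k1.
have {}gamuf : muf != 0 -> ga 0%N = muf by move=> h; apply: gamuf; rewrite lt_def h.
have {}bemug : mug != 0 -> be 0%N = mug by move=> h; apply: bemug; rewrite lt_def h.
have al1 := alpha_le1 par muf0 mug0 gamuf bemug L0 step init.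
apply: (theta_le_rate (al := al)) => //.
- by case: par.
- exact: (thetaS par).
- exact: opnorm_ge0.
- exact: opnorm_ge0.
- exact: (relaxationE par gamuf (gammaS par)).
- exact: (relaxationE par bemug (betaS par)).
- exact: (theta_le1 par).
Qed.

End Convergence.

Theorem theorem4p3 (R : realType) (Lf : R) :
  exists2 C : R, 0 < C &
  forall (m n r : nat) (X : set 'cV[R]_m) (Y : set 'cV[R]_n)
    (A : 'M[R]_(r, m)) (B : 'M[R]_(r, n)) (b : 'cV[R]_r)
    (f f1 f2 : 'cV[R]_m -> \bar R) (g : 'cV[R]_n -> \bar R)
    (mu_f mu_g : R) (alpha theta gamma beta : nat -> R)
    (u v x : nat -> 'cV[R]_m) (y w : nat -> 'cV[R]_n)
    (lam lbar : nat -> 'cV[R]_r)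
    (xs : 'cV[R]_m) (ys : 'cV[R]_n) (ls : 'cV[R]_r),
  closed X -> convex_set X -> closed Y -> convex_set Y ->
  proper_closed_convex f -> proper_closed_convex g ->
  saddle_point X Y A B b f g xs ys ls ->
  0 <= mu_f -> 0 <= mu_g ->
  parameters mu_f mu_g alpha theta gamma beta ->
  let E := lyapunov X Y A B b g theta gamma beta v x y w lam f xs ys ls in
  let residual k := enorm (A *m x k + B *m y k - b) in
  let R0 :=
    (sqrte (2%:E * E 0%N) + (enorm (lam 0%N - ls))%:E + (residual 0%N)%:E)%E in
  (scheme_H X Y A B b f1 f2 g mu_f mu_g alpha theta gamma beta
     u v x y w lam lbar /\
   lbar_choice A B b alpha theta v w lam lbar
   <->
   algorithm X Y A B b f1 f2 g mu_f mu_g alpha theta gamma beta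
     u v x y w lam lbar)
  /\
  (algorithm X Y A B b f1 f2 g mu_f mu_g alpha theta gamma beta
     u v x y w lam lbar ->
   class_S0 mu_g Y g ->
   (forall z, f z = (f1 z + f2 z)%E) ->
   class_S0 0 X f2 ->
   class_S11 mu_f Lf X f1 ->
   mu_f <= Lf ->
   (0 < mu_f -> gamma 0%N = mu_f) ->
   (0 < mu_g -> beta 0%N = mu_g) ->
   (forall k,
      (Lf * beta k * theta k + 2 * beta k * opnorm A ^+ 2
       + 2 * gamma k * opnorm B ^+ 2) * alpha k ^+ 2
      = gamma k * beta k * theta k) ->
   [/\ forall k, (1 <= k)%N -> X (x k) /\ Y (y k),
       forall k, (E k <= (theta k)%:E * E 0%N)%E
     & gamma 0%N * beta 0%N
         <= Lf * beta 0%N + 2 * beta 0%N * opnorm A ^+ 2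
            + 2 * gamma 0%N * opnorm B ^+ 2 ->
       [/\ forall k, ((residual k)%:E <= (theta k)%:E * R0)%E,
           forall k,
             (`|objective f g (x k) (y k) - objective f g xs ys|
                <= (theta k)%:E * (E 0%N + (enorm ls)%:E * R0))%E
         & forall k, (1 <= k)%N ->
             ((theta k)%:E <=
                C%:E * rate (opnorm A) (opnorm B) Lf mu_f mu_g
                         (gamma 0%N) (beta 0%N) k)%E]]).
Proof.
(* The factor 288 comes from [theta_decay], and 32 from comparing the exponential with
   [L / (mu k^2)]. *)
exists (288 * 32) => [|m n r X Y A B b f f1 f2 g mu_f mu_g alpha theta gamma beta
  u v x y w lam lbar xs ys ls _ cX _ cY _ _ saddle muf0 mug0 par E residual R0].
  by rewrite mulr_gt0.
split; first exact: (scheme_H_algorithm muf0 mug0 par).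
move=> alg S0g fE S0f2 S11f1 mufL gamuf bemug step.
split=> [k k1|k|init].
- exact: (iterates_feasible cX muf0 mug0 par alg).
- exact: (lyapunov_le cX cY saddle muf0 mug0 mufL par alg fE S0g S0f2 S11f1 step).
- split=> k.
  + exact: (residual_bound cX cY saddle muf0 mug0 mufL par alg fE S0g S0f2 S11f1 step).
  + exact: (objective_bound cX cY saddle muf0 mug0 mufL par alg fE S0g S0f2 S11f1 step).
  + exact: (theta_bound muf0 mug0 mufL par step).
Qed.
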